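(* $(\mathcal{H},\mathbf{m},\delta,\varepsilon)$ is a Hopf algebra in the category of right $(\mathcal{H},\mathbf{m},\Delta,\varepsilon)$-comodules via the coaction map $\rho:\mathcal{H}\to\mathcal{H}\otimes\mathcal{H}$.
   Context: Let $X=\{x_0,x_1\}$, let $X^*$ be the free monoid of words over $X$, with empty word denoted $\emptyset$ (also written $1$), and let $\mathbb{R}\langle\langle X\rangle\rangle$ be the space of all formal power series $c=\sum_{\eta\in X^*}c(\eta)\eta$ with $c(\eta)\in\mathbb{R}$; $c(1)$ is the coefficient of the empty word. For a letter $x_i$, $x_i c$ denotes left concatenation, $x_ic=\sum_\eta c(\eta)\,x_i\eta$. The shuffle product $\sqcup\!\sqcup$ on $\mathbb{R}\langle\langle X\rangle\rangle$ is the commutative associative product with unit $\emptyset$ determined (bilinearly, extended to series) by $(x_i\eta)\sqcup\!\sqcup(x_j\xi)=x_i(\eta\sqcup\!\sqcup x_j\xi)+x_j(x_i\eta\sqcup\!\sqcup\xi)$. Let $\mathbb{R}\langle\langle X\rangle\rangle^2$ be the space of pairs $\mathbf{c}=[c_1\;c_2]^t=c_1\mathrm{e}_1+c_2\mathrm{e}_2$ with $c_1,c_2\in\mathbb{R}\langle\langle X\rangle\rangle$. For $c\in\mathbb{R}\langle\langle X\rangle\rangle$ and $\mathbf{d}=[d_1\;d_2]^t$ let $c\,\tilde\circ\,\mathbf{d}:=\sum_{\eta\in X^*}c(\eta)\,(\eta\,\tilde\circ\,\mathbf{d})$, where inductively $\emptyset\,\tilde\circ\,\mathbf{d}=\emptyset$,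 $\;x_0\eta\,\tilde\circ\,\mathbf{d}=x_0(\eta\,\tilde\circ\,\mathbf{d})$, $\;x_1\eta\,\tilde\circ\,\mathbf{d}=x_1\big(d_1\sqcup\!\sqcup(\eta\,\tilde\circ\,\mathbf{d})\big)+x_0\big(d_2\sqcup\!\sqcup(\eta\,\tilde\circ\,\mathbf{d})\big)$, and $\mathbf{c}\triangleleft\mathbf{d}:=[c_1\,\tilde\circ\,\mathbf{d}\;\;c_2\,\tilde\circ\,\mathbf{d}]^t$. Let $G:=\{\mathbf{c}\in\mathbb{R}\langle\langle X\rangle\rangle^2: c_1(1)=1\}$, with group product $\mathbf{c}\cdot\mathbf{d}:=[\,c_1\sqcup\!\sqcup d_1\;\;\; c_2+(c_1\sqcup\!\sqcup d_2)\,]^t$, identity $\mathbf{e}=[\emptyset\;\;0]^t$, and second group product $\mathbf{c}\star\mathbf{d}:=(\mathbf{c}\triangleleft\mathbf{d})\cdot\mathbf{d}$. Coordinate functions: for $\eta\in X^*$ and $i=1,2$ let $\eta\epsilon_i$ denote the function $\mathbf{c}\mapsto c_i(\eta)$. Let $\mathbb{R}\langle X\rangle^2$ be the vector space with basis $\{\eta\epsilon_i\}$, and let $\mathcal{H}:=\mathcal{S}(\mathbb{R}\langle X\rangle^2)/(1\epsilon_1-\mathbf{1})$, where $\mathcal{S}$ is the free symmetric (commutative polynomial) algebra with unit $\mathbf{1}$; the product of $\mathcal{H}$ is denoted $\mathbf{m}$. Elements of $\mathcal{H}$ are regarded as (polynomial) functions on $G$ and elements of $\mathcal{H}\otimes\mathcal{H}$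 as functions on $G\times G$. Define unital algebra morphisms $\delta,\Delta,\rho:\mathcal{H}\to\mathcal{H}\otimes\mathcal{H}$ on generators by $\delta(\eta\epsilon_i)(\mathbf{c}\otimes\mathbf{d})=(\mathbf{c}\cdot\mathbf{d})_i(\eta)$, $\;\Delta(\eta\epsilon_i)(\mathbf{c}\otimes\mathbf{d})=(\mathbf{c}\star\mathbf{d})_i(\eta)$, $\;\rho(\eta\epsilon_i)(\mathbf{c}\otimes\mathbf{d})=(\mathbf{c}\triangleleft\mathbf{d})_i(\eta)$ for all $\mathbf{c},\mathbf{d}\in G$. The counit $\varepsilon:\mathcal{H}\to\mathbb{R}$ is the algebra morphism with $\varepsilon(\mathbf{1})=1$ and vanishing on all $\eta\epsilon_i\neq 1\epsilon_1$ (i.e. evaluation at $\mathbf{e}$). The category of right comodules over the commutative bialgebra $(\mathcal{H},\mathbf{m},\Delta,\varepsilon)$ is monoidal, with the coaction on a tensor product of comodules obtained by applying both coactions and multiplying the two right-hand $\mathcal{H}$ factors by $\mathbf{m}$, and with trivial coaction on $\mathbb{R}$. To say that $(\mathcal{H},\mathbf{m},\delta,\varepsilon)$ is a Hopf algebra in this category via $\rho$ means that $\rho$ is a right coaction of $(\mathcal{H},\Delta,\varepsilon)$ on $\mathcal{H}$, that $(\mathcal{H},\mathbf{m},\mathbf{1},\delta,\varepsilon)$ is a Hopf algebra, and that its structure maps (product, unit, coproduct $\delta$, counit, antipode) are morphisms of right comodules. *)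

(* Defs.v *)
(* MathComp, with classical logic (boolp) to form quotients by undecided
   relations, realType for the real numbers and monalg for polynomials in
   infinitely many commuting variables. *)
From HB Require Import structures.
From mathcomp Require Import all_boot all_order all_algebra.
From mathcomp Require Import boolp reals.
From mathcomp Require Import finmap monalg.

Set Implicit Arguments.
Unset Strict Implicit.
Unset Printing Implicit Defensive.

Import GRing.Theory.

Local Open Scope ring_scope.
Local Open Scope quotient_scope.

Declare Scope tensor_scope.
Delimit Scope tensor_scope with T.
Local Open Scope tensor_scope.

Reserved Notation "V ⊗ W" (at level 40, left associativity).

(** * Tensor products of modules *)

Section Tensor.
Variables (R : comNzRingType) (V W : lmodType R).

(* The span, in the free module on V * W, of the bilinearity relators. *)
Inductive tensor_rel : {malg R[(V * W)%type]} -> Prop :=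
| TensorRel0 : tensor_rel 0
| TensorRelZD a x y : tensor_rel x -> tensor_rel y -> tensor_rel (a *: x + y)
| TensorRelDl v v' w :
    tensor_rel (<< (v + v', w) >> - << (v, w) >> - << (v', w) >>)
| TensorRelDr v w w' :
    tensor_rel (<< (v, w + w') >> - << (v, w) >> - << (v, w') >>)
| TensorRelZl a v w : tensor_rel (<< (a *: v, w) >> - a *: << (v, w) >>)
| TensorRelZr a v w : tensor_rel (<< (v, a *: w) >> - a *: << (v, w) >>).

Definition tensor_pred (x : {malg R[(V * W)%type]}) : bool := `[< tensor_rel x >].

Lemma tensor_relZ a x : tensor_rel x -> tensor_rel (a *: x).
Proof. by move=> rx; rewrite -[_ *: _]addr0; apply: TensorRelZD => //; apply: TensorRel0. Qed.

Fact tensor_pred_zmod_closed : zmod_closed tensor_pred.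
Proof.
split=> [|x y]; first by apply/asboolP; apply: TensorRel0.
move=> /asboolP rx /asboolP ry; apply/asboolP.
by rewrite addrC -scaleN1r; apply: TensorRelZD.
Qed.
HB.instance Definition _ :=
  GRing.isZmodClosed.Build {malg R[(V * W)%type]} tensor_pred
    tensor_pred_zmod_closed.

Definition tensor_sub : zmodClosed {malg R[(V * W)%type]} :=
  GRing.ZmodClosed.clone _ tensor_pred _.

Definition tensor := @Quotient.quot {malg R[(V * W)%type]} tensor_sub.
HB.instance Definition _ := GRing.Zmodule.on tensor.
HB.instance Definition _ := EqQuotient.on tensor.

Definition tens_pi (x : {malg R[(V * W)%type]}) : tensor := \pi_tensor x.
Definition tens_repr (t : tensor) : {malg R[(V * W)%type]} := repr t.

Definition tens_scale (a : R) (t : tensor) : tensor :=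
  tens_pi (a *: tens_repr t).

Lemma tens_piP x y : tens_pi x = tens_pi y <-> tensor_rel (x - y).
Proof.
split=> [/eqmodP|h]; first by move=> /asboolP.
by apply/eqmodP/asboolP.
Qed.

Lemma tens_piK (t : tensor) : tens_pi (tens_repr t) = t.
Proof. exact: reprK. Qed.

Lemma tens_piD x y : tens_pi (x + y) = tens_pi x + tens_pi y.
Proof. exact: raddfD. Qed.

Lemma tens_piZ_def a x : tens_pi (a *: x) = tens_scale a (tens_pi x).
Proof.
apply/tens_piP; rewrite -scalerBr; apply: tensor_relZ.
by apply/tens_piP; rewrite tens_piK.
Qed.

Fact tens_scaleA a b t : tens_scale a (tens_scale b t) = tens_scale (a * b) t.
Proof. by rewrite -[t]tens_piK -!tens_piZ_def scalerA. Qed.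
Fact tens_scale1 : left_id 1 tens_scale.
Proof. by move=> t; rewrite -[t]tens_piK -!tens_piZ_def scale1r. Qed.
Fact tens_scaleDr : right_distributive tens_scale +%R.
Proof.
move=> a t u; rewrite -[t]tens_piK -[u]tens_piK.
by rewrite -tens_piD -!tens_piZ_def -tens_piD scalerDr.
Qed.
Fact tens_scaleDl t : {morph tens_scale^~ t : a b / a + b}.
Proof.
by move=> a b; rewrite -[t]tens_piK -!tens_piZ_def -tens_piD scalerDl.
Qed.
HB.instance Definition _ := GRing.Zmodule_isLmodule.Build R tensor
  tens_scaleA tens_scale1 tens_scaleDr tens_scaleDl.

Lemma tens_piZ a x : tens_pi (a *: x) = a *: tens_pi x.
Proof. exact: tens_piZ_def. Qed.

Definition tens (v : V) (w : W) : tensor := tens_pi << (v, w) >>.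

(* The linear map v ⊗ w |-> f v w; meaningful when f is bilinear, see tliftE. *)
Definition tlift (U : lmodType R) (f : V -> W -> U) (t : tensor) : U :=
  let x := tens_repr t in
  \sum_(p <- msupp x) x@_p *: f p.1 p.2.

Definition is_bilinear (U : lmodType R) (f : V -> W -> U) : Prop :=
  (forall w, linear (f^~ w)) /\ (forall v, linear (f v)).

End Tensor.

Notation "v ⊗ w" := (tens v w) : tensor_scope.

Section TensorTheory.
Variables (R : comNzRingType) (V W : lmodType R).

Lemma tens_bilinear : is_bilinear (@tens R V W).
Proof.
split=> [w a v v'|v a w w']; rewrite -tens_piZ -tens_piD; apply/tens_piP.
  rewrite (_ : _ - _ = 1 *: (<< (a *: v + v', w) >> - << (a *: v, w) >>
     - << (v', w) >>) + (<< (a *: v, w) >> - a *: << (v, w) >>)).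
    by apply: TensorRelZD; [apply: TensorRelDl | apply: TensorRelZl].
  by rewrite scale1r [RHS]addrAC addrA subrK opprD addrA.
rewrite (_ : _ - _ = 1 *: (<< (v, a *: w + w') >> - << (v, a *: w) >>
   - << (v, w') >>) + (<< (v, a *: w) >> - a *: << (v, w) >>)).
  by apply: TensorRelZD; [apply: TensorRelDr | apply: TensorRelZr].
by rewrite scale1r [RHS]addrAC addrA subrK opprD addrA.
Qed.

Section Lift.
Variables (U : lmodType R) (f : V -> W -> U).

Let F (x : {malg R[(V * W)%type]}) : U := \sum_(p <- msupp x) x@_p *: f p.1 p.2.

Let FE (d : {fset (V * W)%type}) x : fsubset (msupp x) d ->
  F x = \sum_(p <- d) x@_p *: f p.1 p.2.
Proof.
move=> sub; apply: big_fset_incl => // p _ /mcoeff_outdom ->.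
by rewrite scale0r.
Qed.

Let F_linear : linear F.
Proof.
move=> a x y; pose d := fsetU (msupp x) (msupp y).
rewrite (@FE d x) ?fsubsetUl // (@FE d y) ?fsubsetUr // (@FE d).
  rewrite scaler_sumr -big_split; apply: eq_bigr => p _ /=.
  by rewrite mcoeffD mcoeffZ scalerDl scalerA.
apply: fsubset_trans (msuppD_le _ _) _.
by apply: fsetUSS => //; apply: msuppZ_le.
Qed.

Let FU v w : F << (v, w) >> = f v w.
Proof. by rewrite /F msuppU oner_eq0 big_seq_fset1 mcoeffUU scale1r. Qed.

Hypothesis fB : is_bilinear f.

Let F_rel x : tensor_rel x -> F x = 0.
Proof.
pose FL := GRing.isLinear.Build R _ _ _ F F_linear.
pose L : {linear {malg R[(V * W)%type]} -> U} := HB.pack F FL.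
have FB a b : F (a - b) = F a - F b := raddfB L a b.
have FZ a b : F (a *: b) = a *: F b := linearZZ L a b.
case: fB => fl fr.
have fDl v v' w : f (v + v') w = f v w + f v' w.
  by have := fl w 1 v v'; rewrite !scale1r.
have fDr v w w' : f v (w + w') = f v w + f v w'.
  by have := fr v 1 w w'; rewrite !scale1r.
have f0l w : f 0 w = 0 by apply: (addrI (f 0 w)); rewrite -fDl !addr0.
have f0r v : f v 0 = 0 by apply: (addrI (f v 0)); rewrite -fDr !addr0.
have fZl a v w : f (a *: v) w = a *: f v w.
  by have := fl w a v 0; rewrite f0l !addr0.
have fZr a v w : f v (a *: w) = a *: f v w.
  by have := fr v a w 0; rewrite f0r !addr0.
elim=> [|a {}x y _ IHx _ IHy|v v' w|v w w'|a v w|a v w].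
- exact: (raddf0 L).
- by rewrite F_linear IHx IHy scaler0 addr0.
- by rewrite !FB !FU fDl addrAC addrK subrr.
- by rewrite !FB !FU fDr addrAC addrK subrr.
- by rewrite FB FZ !FU fZl subrr.
- by rewrite FB FZ !FU fZr subrr.
Qed.

Let tlift_pi x : tlift f (tens_pi x) = F x.
Proof.
pose FL := GRing.isLinear.Build R _ _ _ F F_linear.
pose L : {linear {malg R[(V * W)%type]} -> U} := HB.pack F FL.
apply/eqP; rewrite -subr_eq0 -[tlift _ _]/(L _) -[F x]/(L x) -raddfB.
by apply/eqP/F_rel/tens_piP; rewrite tens_piK.
Qed.

Lemma tlift_linear : linear (tlift f).
Proof.
move=> a t u; rewrite -[t]tens_piK -[u]tens_piK -tens_piZ -tens_piD.
by rewrite !tlift_pi F_linear.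
Qed.

Lemma tliftE v w : tlift f (v ⊗ w) = f v w.
Proof. by rewrite tlift_pi FU. Qed.

End Lift.

Lemma tensor_ind (P : tensor V W -> Prop) :
  P 0 -> (forall a v w t, P t -> P (a *: (v ⊗ w) + t)) -> forall t, P t.
Proof.
move=> P0 PD t; rewrite -[t]tens_piK; set x := tens_repr _.
rewrite [x]monalgE; elim: (enum_fset _) => [|[v w] s IHs].
  by rewrite big_nil /tens_pi raddf0.
rewrite big_cons tens_piD.
rewrite (_ : << x@_(v, w) *g (v, w) >> = x@_(v, w) *: << (v, w) >>).
  by rewrite tens_piZ; apply: PD.
by apply/malgP=> k; rewrite mcoeffZ !mcoeffU mulrnAr mulr1.
Qed.

End TensorTheory.

Section TensorMaps.
Variable R : comNzRingType.
Implicit Types U V W : lmodType R.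

Definition tmap V V' W W' (f : V -> V') (g : W -> W') :
    tensor V W -> tensor V' W' :=
  tlift (fun v w => f v ⊗ g w).

Definition tassoc U V W : tensor (tensor U V) W -> tensor U (tensor V W) :=
  tlift (fun t w => tlift (fun u v => u ⊗ (v ⊗ w)) t).

Definition tunitl V : tensor R^o V -> V := tlift (fun (r : R^o) v => r *: v).
Definition tunitr V : tensor V R^o -> V := tlift (fun v (r : R^o) => r *: v).

Definition tmul (A : algType R) : tensor A A -> A := tlift (@GRing.mul A).

(* (a ⊗ b) (a' ⊗ b') = a a' ⊗ b b' *)
Definition tens_mul (A B : algType R) (s t : tensor A B) : tensor A B :=
  tlift (fun a b => tlift (fun a' b' => (a * a') ⊗ (b * b')) t) s.

End TensorMaps.

(** * Hopf algebras and comodules *)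

Section Hopf.
Variable R : comNzRingType.

Record is_coalgebra (C : lmodType R) (delta : C -> tensor C C)
    (eps : C -> R^o) : Prop := {
  coalg_delta_linear : linear delta;
  coalg_eps_linear : linear eps;
  coalg_coassoc : forall x, tassoc (tmap delta id (delta x)) = tmap id delta (delta x);
  coalg_counitl : forall x, tunitl (tmap eps id (delta x)) = x;
  coalg_counitr : forall x, tunitr (tmap id eps (delta x)) = x
}.

Record is_alg_morph (A B : algType R) (f : A -> B) : Prop := {
  alg_morph_linear : linear f;
  alg_morph1 : f 1 = 1;
  alg_morphM : forall x y, f (x * y) = f x * f y
}.

Record is_tens_alg_morph (A B B' : algType R) (f : A -> tensor B B') : Prop := {
  tens_alg_morph_linear : linear f;
  tens_alg_morph1 : f 1 = 1 ⊗ 1;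
  tens_alg_morphM : forall x y, f (x * y) = tens_mul (f x) (f y)
}.

Record is_bialgebra (A : algType R) (delta : A -> tensor A A)
    (eps : A -> R^o) : Prop := {
  bialg_coalgebra : is_coalgebra delta eps;
  bialg_delta : is_tens_alg_morph delta;
  bialg_eps : is_alg_morph eps
}.

Record is_antipode (A : algType R) (delta : A -> tensor A A)
    (eps : A -> R^o) (S : A -> A) : Prop := {
  antipode_linear : linear S;
  antipodel : forall x, tmul (tmap S id (delta x)) = (eps x)%:A;
  antipoder : forall x, tmul (tmap id S (delta x)) = (eps x)%:A
}.

Section Comodules.
Variable C : comAlgType R.

Record is_coaction (delta : C -> tensor C C) (eps : C -> R^o)
    (V : lmodType R) (rho : V -> tensor V C) : Prop := {
  coaction_linear : linear rho;
  coaction_coassoc : forall v,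
    tassoc (tmap rho id (rho v)) = tmap id delta (rho v);
  coaction_counit : forall v, tunitr (tmap id eps (rho v)) = v
}.

Record is_comod_morph (V W : lmodType R) (rhoV : V -> tensor V C)
    (rhoW : W -> tensor W C) (f : V -> W) : Prop := {
  comod_morph_linear : linear f;
  comod_morphE : forall v, rhoW (f v) = tmap f id (rhoV v)
}.

(* (v ⊗ a) ⊗ (w ⊗ b) |-> (v ⊗ w) ⊗ (a b), after both coactions *)
Definition tens_coaction (V W : lmodType R) (rhoV : V -> tensor V C)
    (rhoW : W -> tensor W C) (t : tensor V W) : tensor (tensor V W) C :=
  tlift (fun p q =>
    tlift (fun v a => tlift (fun w b => (v ⊗ w) ⊗ (a * b)) q) p)
    (tmap rhoV rhoW t).

Definition triv_coaction (r : R^o) : tensor R^o C := r ⊗ 1.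

(* (A, delta, eps) is a Hopf algebra, via rho, in the monoidal category of
   right comodules over the commutative bialgebra (C, Delta, epsC). *)
Record is_Hopf_in_comod (Delta : C -> tensor C C) (epsC : C -> R^o)
    (A : algType R) (delta : A -> tensor A A) (eps : A -> R^o)
    (rho : A -> tensor A C) : Prop := {
  Hopf_base_bialgebra : is_bialgebra Delta epsC;
  Hopf_coaction : is_coaction Delta epsC rho;
  Hopf_bialgebra : is_bialgebra delta eps;
  Hopf_mul_comod : is_comod_morph (tens_coaction rho rho) rho (@tmul R A);
  Hopf_unit_comod : is_comod_morph triv_coaction rho (fun r : R^o => r%:A);
  Hopf_delta_comod : is_comod_morph rho (tens_coaction rho rho) delta;
  Hopf_eps_comod : is_comod_morph rho triv_coaction eps;
  Hopf_antipode_comod : exists2 S : A -> A,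
    is_antipode delta eps S & is_comod_morph rho rho S
}.

End Comodules.
End Hopf.

(** * Formal power series in two noncommuting letters *)

Definition letter := bool.
Definition x0 : letter := false.
Definition x1 : letter := true.
Definition word := seq letter.

(* Terms, with multiplicity, of the shuffle product of two words. *)
Fixpoint shuffle_words (u v : word) {struct u} : seq word :=
  match u with
  | [::] => [:: v]
  | i :: u' =>
    (fix aux (v : word) : seq word :=
       match v with
       | [::] => [:: u]
       | j :: v' =>
         [seq i :: w | w <- shuffle_words u' v] ++ [seq j :: w | w <- aux v']
       end) v
  end.

Lemma shuffle_words_cons i u j v : shuffle_words (i :: u) (j :: v) =
  [seq i :: w | w <- shuffle_words u (j :: v)] ++
  [seq j :: w | w <- shuffle_words (i :: u) v].
Proof. by []. Qed.

Section Series.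
Variable R : realType.

Definition series := word -> R.
(* The pair [c_1 c_2]^t. *)
Definition series2 := (series * series)%type.

Definition series0 : series := fun=> 0.
Definition series1 : series := fun w => (w == [::])%:R.
Definition series_add (c d : series) : series := fun w => c w + d w.
Definition lconcat (i : letter) (c : series) : series :=
  fun w => if w is j :: w' then (if j == i then c w' else 0) else 0.

Definition word_sum (n : nat) (F : word -> R) : R :=
  \sum_(k < n.+1) \sum_(u : k.-tuple letter) F u.

(* Only words no longer than w contribute to the coefficient of w, see
   shuffle_coef_size; hence the bounds on the sums. *)
Definition shuffle (c d : series) : series := fun w =>
  word_sum (size w) (fun u => word_sum (size w) (fun v =>
    c u * d v * (count_mem w (shuffle_words u v))%:R)).

Fixpoint word_comp (eta : word) (d : series2) : series :=
  match eta with
  | [::] => series1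
  | i :: eta' =>
    let e := word_comp eta' d in
    if i == x0 then lconcat x0 e
    else series_add (lconcat x1 (shuffle d.1 e)) (lconcat x0 (shuffle d.2 e))
  end.

(* The sum of c(eta) (eta \tilde\circ d) over all words eta; those longer than
   w do not contribute to the coefficient of w, see word_comp_size. *)
Definition comp (c : series) (d : series2) : series := fun w =>
  word_sum (size w) (fun eta => c eta * word_comp eta d w).

Definition tri (c d : series2) : series2 := (comp c.1 d, comp c.2 d).

Definition dot (c d : series2) : series2 :=
  (shuffle c.1 d.1, series_add c.2 (shuffle c.1 d.2)).

Definition star (c d : series2) : series2 := dot (tri c d) d.

Definition inG (c : series2) : Prop := c.1 [::] = 1.

Lemma shuffle_coef_size u v w :
  w \in shuffle_words u v -> size w = (size u + size v)%N.
Proof.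
elim: u v w => [|i u IHu] v w; first by rewrite inE => /eqP ->.
elim: v w => [|j v IHv] w; first by rewrite inE => /eqP ->; rewrite addn0.
rewrite shuffle_words_cons mem_cat => /orP[] /mapP[w' w'in ->] /=.
  by rewrite (IHu _ _ w'in).
by rewrite (IHv _ w'in) /= !addnS.
Qed.

Lemma word_comp_size eta d w :
  (size w < size eta)%N -> word_comp eta d w = 0.
Proof.
have wsum0 n F : (forall u, (size u <= n)%N -> F u = 0) -> word_sum n F = 0.
  move=> F0; rewrite /word_sum big1 // => k _; rewrite big1 // => u _.
  by apply: F0; rewrite size_tuple -ltnS.
elim: eta w => [|i eta IH] [|j w] //=.
  by case: ifP; rewrite /series_add //= addr0.
rewrite ltnS => lt_w.
have sh0 c : shuffle c (word_comp eta d) w = 0.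
  apply: (wsum0) => u _; apply: wsum0 => v le_v.
  by rewrite IH ?mulr0 ?mul0r // (leq_ltn_trans le_v).
by case: ifP; rewrite /series_add /= !(IH, sh0) //; do !case: ifP; rewrite ?addr0.
Qed.

End Series.

(** * The algebra H of coordinate functions *)

(* The basis of R<X>^2: inl eta stands for eta \epsilon_1 and inr eta for
   eta \epsilon_2. *)
Definition coord_index : choiceType := (word + word)%type.

Section CoordinateAlgebra.
Variable R : realType.

Definition coord (c : series2 R) (g : coord_index) : R :=
  match g with inl eta => c.1 eta | inr eta => c.2 eta end.

(* The symmetric algebra of R<X>^2: polynomials in its basis vectors. *)
Definition symalg : comAlgType R := {malg R[{cmonom coord_index}]}.

Definition symgen (g : coord_index) : symalg := << ucm g >>.

Definition monom_eval (c : series2 R) (m : {cmonom coord_index}) : R :=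
  \prod_(g <- finsupp m) coord c g ^+ m g.

Definition symeval (c : series2 R) (p : symalg) : R :=
  mmap idfun (monom_eval c) p.

Fact monom_eval_mmorphism c : mmorphism (monom_eval c).
Proof.
have E (d : {fset coord_index}) (m : {cmonom coord_index}) :
    fsubset (finsupp m) d ->
    monom_eval c m = \prod_(g <- d) coord c g ^+ m g.
  move=> sub; apply: big_fset_incl => // g _.
  by rewrite -cmE_eq0 => /eqP ->.
split=> [m m'|]; last by rewrite /monom_eval mdom1 big_seq_fset0.
pose d := fsetU (finsupp m) (finsupp m').
rewrite (E d m) ?fsubsetUl // (E d m') ?fsubsetUr // (E d) ?mdomD //.
by rewrite -big_split; apply: eq_bigr => g _; rewrite cmM exprD.
Qed.
HB.instance Definition _ c := isMultiplicative.Build _ _ (monom_eval c)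
  (monom_eval_mmorphism c).

Lemma symeval1 c : symeval c 1 = 1.
Proof. exact: (rmorph1 (mmap idfun (monom_eval c))). Qed.
Lemma symevalB c p q : symeval c (p - q) = symeval c p - symeval c q.
Proof. exact: (rmorphB (mmap idfun (monom_eval c))). Qed.
Lemma symevalM c p q : symeval c (p * q) = symeval c p * symeval c q.
Proof. exact: (rmorphM (mmap idfun (monom_eval c))). Qed.
(* Rewriting with symeval_gen a term containing symeval c 1 diverges: it tries
   to unify 1 and symgen g. *)
Lemma symevalB1 c p : symeval c (p - 1) = symeval c p - 1.
Proof. by rewrite symevalB symeval1. Qed.
Lemma symevalP c a p q : symeval c (a *: p + q) = a * symeval c p + symeval c q.
Proof. exact: (linearP (mmap idfun (monom_eval c))). Qed.

Lemma symeval_gen c g : symeval c (symgen g) = coord c g.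
Proof.
rewrite /symeval /symgen mmapU /= mul1r /monom_eval mdomU.
by rewrite big_seq_fset1 cmUU expr1.
Qed.

(* The ideal generated by 1\epsilon_1 - \mathbf{1}. *)
Definition unit_ideal (p : symalg) : bool :=
  `[< exists q, p = q * (symgen (inl [::]) - 1) >].

Lemma symeval_ideal c p : inG c -> unit_ideal p -> symeval c p = 0.
Proof.
move=> Gc /asboolP[q ->].
by rewrite symevalM symevalB1 symeval_gen /= Gc subrr mulr0.
Qed.

Fact unit_ideal_closed : idealr_closed unit_ideal.
Proof.
split=> [||a p q /asboolP[p' ->] /asboolP[q' ->]].
- by apply/asboolP; exists 0; rewrite mul0r.
- apply/negP => /(@symeval_ideal (@series1 R, @series0 R) _ erefl) /eqP.
  by rewrite symeval1 oner_eq0.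
- by apply/asboolP; exists (a * p' + q'); rewrite mulrDl mulrA.
Qed.
HB.instance Definition _ := isIdealr.Build symalg unit_ideal unit_ideal_closed.

Definition unit_idealr : idealr symalg := Idealr.clone _ unit_ideal _.

Definition Halg := {ideal_quot unit_idealr}.
HB.instance Definition _ := GRing.ComNzRing.on Halg.
HB.instance Definition _ := EqQuotient.on Halg.

Definition Hpi (p : symalg) : Halg := \pi_Halg p.
Definition Hrepr (x : Halg) : symalg := repr x.

Definition Hscale (a : R) (x : Halg) : Halg := Hpi (a *: Hrepr x).

Lemma HpiK x : Hpi (Hrepr x) = x. Proof. exact: reprK. Qed.
Lemma HpiD p q : Hpi (p + q) = Hpi p + Hpi q. Proof. exact: rmorphD. Qed.
Lemma HpiM p q : Hpi (p * q) = Hpi p * Hpi q. Proof. exact: rmorphM. Qed.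
Lemma Hpi1 : Hpi 1 = 1. Proof. exact: rmorph1. Qed.
Lemma HpiP p q : Hpi p = Hpi q <-> unit_ideal (p - q).
Proof. by split=> [/eqmodP|h] //; apply/eqmodP. Qed.

Fact HpiZ_def a p : Hpi (a *: p) = Hscale a (Hpi p).
Proof.
apply/HpiP; rewrite -scalerBr.
have /HpiP/asboolP[q ->] : Hpi p = Hpi (Hrepr (Hpi p)) by rewrite HpiK.
by apply/asboolP; exists (a *: q); rewrite scalerAl.
Qed.

Fact HscaleA a b x : Hscale a (Hscale b x) = Hscale (a * b) x.
Proof. by rewrite -[x]HpiK -!HpiZ_def scalerA. Qed.
Fact Hscale1 : left_id 1 Hscale.
Proof. by move=> x; rewrite -[x]HpiK -!HpiZ_def scale1r. Qed.
Fact HscaleDr : right_distributive Hscale +%R.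
Proof.
by move=> a x y; rewrite -[x]HpiK -[y]HpiK -HpiD -!HpiZ_def -HpiD scalerDr.
Qed.
Fact HscaleDl x : {morph Hscale^~ x : a b / a + b}.
Proof. by move=> a b; rewrite -[x]HpiK -!HpiZ_def -HpiD scalerDl. Qed.
HB.instance Definition _ := GRing.Zmodule_isLmodule.Build R Halg
  HscaleA Hscale1 HscaleDr HscaleDl.

Lemma HpiZ a p : Hpi (a *: p) = a *: Hpi p. Proof. exact: HpiZ_def. Qed.

Fact HscaleAl (a : R) (x y : Halg) : a *: (x * y) = (a *: x) * y.
Proof.
rewrite -[x]HpiK -[y]HpiK; set p := Hrepr x; set q := Hrepr y.
rewrite -(HpiM p q) -(HpiZ a p) -(HpiM (a *: p) q) -(HpiZ a (p * q)).
by congr Hpi; apply: scalerAl.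
Qed.
HB.instance Definition _ := GRing.Lmodule_isLalgebra.Build R Halg HscaleAl.
HB.instance Definition _ := GRing.Lalgebra_isComAlgebra.Build R Halg.

Definition gen (g : coord_index) : Halg := Hpi (symgen g).

(* Evaluation of an element of H at a point of G; it does not depend on the
   representative when c is in G, see Heval_pi. *)
Definition Heval (c : series2 R) (x : Halg) : R^o := symeval c (Hrepr x).

(* Evaluation of an element of H ⊗ H at a point of G * G. *)
Definition Heval2 (c d : series2 R) : tensor Halg Halg -> R^o :=
  tlift (fun x y : Halg => (Heval c x * Heval d y : R^o)).

Lemma Heval_pi c p : inG c -> Heval c (Hpi p) = symeval c p.
Proof.
move=> Gc; apply/eqP; rewrite -subr_eq0 -symevalB; apply/eqP.
by apply: symeval_ideal => //; apply/HpiP; rewrite HpiK.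
Qed.

Lemma Heval_gen c g : inG c -> Heval c (gen g) = coord c g.
Proof. by move=> Gc; rewrite Heval_pi // symeval_gen. Qed.

Lemma Heval2_tens c d x y : inG c -> inG d ->
  Heval2 c d (x ⊗ y) = Heval c x * Heval d y.
Proof.
move=> Gc Gd; have lin e : inG e -> linear (Heval e).
  move=> Ge a u v; rewrite -[u]HpiK -[v]HpiK -HpiZ -HpiD.
  by rewrite !(Heval_pi _ Ge) symevalP.
rewrite /Heval2 tliftE //; split=> [u a v w|u a v w] /=.
  by rewrite lin // mulrDl scalerAl.
by rewrite lin // mulrDr scalerAr.
Qed.

Lemma gen_unit : gen (inl [::]) = 1.
Proof.
rewrite -Hpi1; apply/HpiP/asboolP.
by exists 1; rewrite mul1r.
Qed.

(* f is the algebra morphism dual to the operation op on G. *)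
Definition is_dual_of (op : series2 R -> series2 R -> series2 R)
    (f : Halg -> tensor Halg Halg) : Prop :=
  is_tens_alg_morph f /\
  forall g c d, inG c -> inG d -> Heval2 c d (f (gen g)) = coord (op c d) g.

Definition is_counit (eps : Halg -> R^o) : Prop :=
  is_alg_morph eps /\ forall g, g != inl [::] -> eps (gen g) = 0.

End CoordinateAlgebra.

(* Main.v *)
From mathcomp Require Import all_boot all_order all_algebra.
From mathcomp Require Import boolp reals.
From mathcomp Require Import finmap monalg ring.
Require Import Defs.

Set Implicit Arguments.
Unset Strict Implicit.
Unset Printing Implicit Defensive.

Import Order.TTheory GRing.Theory Num.Theory.

Local Open Scope ring_scope.

(** The proof turns every axiom into an identity between points of the group G.

    Points of G separate H, and pairs and triples of points separate its
    tensor powers.  For H this is Dedekind's independence of characters: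
    monomials are multiplicative characters of G equipped with the
    coordinatewise product, and they are distinct once the variable
    1 epsilon_1, which equals 1 in H, has been removed ([separating_Heval]).
    Over a field, separation passes to tensor products ([separating_tens]).

    An algebra morphism f dual to an operation op on G evaluates as
    f(x)(c, d) = x(op c d) on all of H, not only on generators
    ([dual_eval]), and the counit is evaluation at the unit
    ([counit_eval]).  Hence coassociativity, the counit laws, the coaction law
    and the compatibility of rho with all structure maps amount to the
    following facts on G: the products dot and star are associative with the
    same unit, tri is a right action of star (c ◁ d) ◁ e = c ◁ (d ⋆ e), and
    each - ◁ e is an endomorphism of the group (G, dot), so it commutes with
    inverses.  These come down to two identities between series, namely that
    c |-> c ∘~ d is a shuffle morphism ([comp_shuffle]) and that
    (c ∘~ d) ∘~ e = c ∘~ (d ⋆ e) ([comp_comp]); both are proved coefficient by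
    coefficient, on words, using that the left derivatives
    c |-> (w |-> c(x_i w)) are derivations of the shuffle product
    ([lderiv_shuffle]) and intertwine with ∘~ ([lderiv_comp_x1],
    [lderiv_comp_x0]).

    Conversely an operation has a dual morphism as soon as its coordinates are
    represented in the tensor square ([dual_exists]).  The represented
    functions form an algebra, and the coordinates of shuffles, compositions
    and inverses are polynomial in those of their arguments because each
    involves finitely many words only. *)

(** * Sums over words *)

Section WordSum.
Variable R : realType.
Implicit Types (F G : word -> R) (n : nat).

Lemma eq_word_sum n F G :
  (forall u, (size u <= n)%N -> F u = G u) -> word_sum n F = word_sum n G.
Proof.
move=> FG; apply: eq_bigr => k _; apply: eq_bigr => u _.
by apply: FG; rewrite size_tuple -ltnS.
Qed.

Lemma word_sum0 n F : (forall u, (size u <= n)%N -> F u = 0) -> word_sum n F = 0.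
Proof.
move=> F0; rewrite (eq_word_sum (G := fun=> 0)) //.
by rewrite /word_sum big1 // => k _; rewrite big1.
Qed.

Lemma word_sumD n F G :
  word_sum n (fun u => F u + G u) = word_sum n F + word_sum n G.
Proof.
rewrite /word_sum -big_split; apply: eq_bigr => k _.
by rewrite -big_split.
Qed.

Lemma word_sumZ n a F : word_sum n (fun u => a * F u) = a * word_sum n F.
Proof.
by rewrite /word_sum mulr_sumr; apply: eq_bigr => k _; rewrite mulr_sumr.
Qed.

Lemma word_sum_exchange m n (F : word -> word -> R) :
  word_sum m (fun u => word_sum n (F u)) =
  word_sum n (fun v => word_sum m (F^~ v)).
Proof.
rewrite /word_sum.
under eq_bigr => k _ do rewrite exchange_big /=.
rewrite exchange_big /=; apply: eq_bigr => l _.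
under eq_bigr => k _ do rewrite exchange_big /=.
by rewrite exchange_big.
Qed.

Lemma sum_tuple0 F : \sum_(u : 0.-tuple letter) F u = F [::].
Proof.
by rewrite (big_pred1 [tuple]) // => u; apply/eqP; rewrite /= [u]tuple0; apply/esym/eqP.
Qed.

Lemma sum_tupleS n F : \sum_(u : n.+1.-tuple letter) F u =
  \sum_(i : letter) \sum_(u : n.-tuple letter) F (i :: u).
Proof.
rewrite pair_big /=.
rewrite (reindex (fun p : letter * n.-tuple letter => [tuple of p.1 :: p.2])) //=.
exists (fun t => (thead t, [tuple of behead t])) => [[i u] _|t _] /=.
  by congr pair; apply/val_inj.
by rewrite -tuple_eta.
Qed.

Lemma word_sum_first n F : word_sum n.+1 F =
  F [::] + (word_sum n (fun u => F (x0 :: u)) + word_sum n (fun u => F (x1 :: u))).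
Proof.
rewrite /word_sum big_ord_recl sum_tuple0; congr (_ + _).
rewrite -big_split; apply: eq_bigr => k _ /=.
by rewrite sum_tupleS big_bool addrC.
Qed.

Lemma word_sum_nil F : word_sum 0 F = F [::].
Proof. by rewrite /word_sum big_ord_recl big_ord0 addr0 sum_tuple0. Qed.

(** The length bounds in the definitions of [shuffle] and [comp] can be raised
    freely: longer words contribute zero. *)
Lemma word_sum_trunc m n F : (m <= n)%N ->
  (forall u, (m < size u)%N -> F u = 0) -> word_sum n F = word_sum m F.
Proof.
move=> le_mn F0; elim: n le_mn => [|n IH]; first by rewrite leqn0 => /eqP ->.
rewrite leq_eqVlt => /predU1P[-> //|]; rewrite ltnS => le_mn.
rewrite -(IH le_mn) /word_sum big_ord_recr /= [X in _ + X]big1 ?addr0 // => u _.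
by apply: F0; rewrite size_tuple ltnS.
Qed.

Lemma word_sum_pick n i F :
  (forall u, (size u <= n.+1)%N -> (forall u', u = i :: u' -> False) -> F u = 0) ->
  word_sum n.+1 F = word_sum n (fun u => F (i :: u)).
Proof.
move=> F0; rewrite word_sum_first F0 // add0r.
have F'0 j : j != i -> word_sum n (fun u => F (j :: u)) = 0.
  move=> ne; apply: word_sum0 => u le_u; apply: F0 => // u' [e _].
  by rewrite e eqxx in ne.
case: i F0 F'0 => _ F'0; first by rewrite [X in X + _]F'0 // add0r.
by rewrite [X in _ + X]F'0 // addr0.
Qed.

End WordSum.

(** * The shuffle algebra *)

Section ShuffleWords.

Lemma shuffle_words_nil u : shuffle_words u [::] = [:: u].
Proof. by case: u. Qed.

Lemma count_map_cons (i j : letter) (w : word) (s : seq word) :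
  count_mem (i :: w) [seq j :: v | v <- s] = ((i == j) * count_mem w s)%N.
Proof.
rewrite count_map; case: eqVneq => [->|ne]; rewrite ?mul1n ?mul0n.
  by apply: eq_count => v /=; rewrite eqseq_cons eqxx.
by rewrite -(count_pred0 s); apply: eq_count => v /=; rewrite eqseq_cons eq_sym (negPf ne).
Qed.

(** Left division of a word by a letter. *)
Definition strip (i : letter) (u : word) : option word :=
  if u is j :: u' then if i == j then Some u' else None else None.

(** The first letter of a shuffle comes from one of its two factors; for
    series this becomes the Leibniz rule. *)
Lemma count_shuffle_cons i w u v : count_mem (i :: w) (shuffle_words u v) =
  (oapp (fun u' => count_mem w (shuffle_words u' v)) 0 (strip i u) +
   oapp (fun v' => count_mem w (shuffle_words u v')) 0 (strip i v))%N.
Proof.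
case: u v => [|j u] [|k v] //.
- rewrite /= eqseq_cons eq_sym; case: eqVneq => //= _.
- rewrite /= eqseq_cons eq_sym; case: eqVneq => //= _.
  by rewrite shuffle_words_nil /= !addn0.
rewrite shuffle_words_cons count_cat !count_map_cons /strip.
by case: (i == j); case: (i == k); rewrite ?mul1n ?mul0n.
Qed.

Lemma count_shuffle_size w u v :
  (size u + size v != size w)%N -> count_mem w (shuffle_words u v) = 0%N.
Proof.
by move=> ne; apply/count_memPn; apply: contra ne => /shuffle_coef_size ->.
Qed.

End ShuffleWords.

Section Shuffle.
Variable R : realType.
Implicit Types (a b c d : series R) (w : word) (i : letter).

(** Together with the constant term, the left derivatives determine a series,
    so that identities of series are proved by induction on words. *)
Definition lderiv i c : series R := fun w => c (i :: w).

Lemma shuffle_nil c d : shuffle c d [::] = c [::] * d [::].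
Proof. by rewrite /shuffle /= !word_sum_nil /= mulr1. Qed.

Lemma shuffle_trunc n m c d w : (size w <= n)%N -> (size w <= m)%N ->
  shuffle c d w = word_sum n (fun u => word_sum m (fun v =>
    c u * d v * (count_mem w (shuffle_words u v))%:R)).
Proof.
move=> le_n le_m; rewrite (word_sum_trunc le_n) => [|u lt_u].
  apply: eq_word_sum => u _; rewrite [RHS](word_sum_trunc le_m) // => v lt_v.
  by rewrite count_shuffle_size ?mulr0 // neq_ltn orbC (leq_trans lt_v) ?leq_addl.
apply: word_sum0 => v _.
by rewrite count_shuffle_size ?mulr0 // neq_ltn orbC (leq_trans lt_u) ?leq_addr.
Qed.

(** Leibniz rule, coefficientwise. *)
Lemma shuffle_cons c d i w : shuffle c d (i :: w) =
  shuffle (lderiv i c) d w + shuffle c (lderiv i d) w.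
Proof.
rewrite /shuffle /=; set n := size w.
rewrite [X in _ = X + _](@shuffle_trunc n n.+1) //.
rewrite [X in _ = _ + X](@shuffle_trunc n.+1 n) //.
under eq_word_sum => u _.
  under eq_word_sum => v _ do rewrite count_shuffle_cons natrD mulrDr.
  rewrite word_sumD; over.
rewrite word_sumD; congr (_ + _).
  rewrite (@word_sum_pick _ n i) => [|u _ Nu].
    by apply: eq_word_sum => u _; apply: eq_word_sum => v _; rewrite /= eqxx.
  apply: word_sum0 => v _; case: u Nu => [|j u] Nu /=; first by rewrite mulr0.
  by case: eqVneq => [e|_]; [case: (Nu u); rewrite e | rewrite mulr0].
apply: eq_word_sum => u _; rewrite (@word_sum_pick _ n i) => [|v _ Nv].
  by apply: eq_word_sum => v _; rewrite /= eqxx.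
case: v Nv => [|j v] Nv /=; first by rewrite mulr0.
by case: eqVneq => [e|_]; [case: (Nv v); rewrite e | rewrite mulr0].
Qed.

Lemma lderiv_shuffle i c d : lderiv i (shuffle c d) =
  series_add (shuffle (lderiv i c) d) (shuffle c (lderiv i d)).
Proof. by apply/funext => w; rewrite /lderiv shuffle_cons. Qed.

(** Lets an induction hypothesis on short words be used inside a shuffle. *)
Lemma eq_shuffle n c c' d d' w : (size w <= n)%N ->
  (forall v, (size v <= n)%N -> c v = c' v) ->
  (forall v, (size v <= n)%N -> d v = d' v) ->
  shuffle c d w = shuffle c' d' w.
Proof.
move=> le_n ec ed; apply: eq_word_sum => u le_u; apply: eq_word_sum => v le_v.
by rewrite ec ?ed // (leq_trans _ le_n).
Qed.

Lemma shuffleDl a b c :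
  shuffle (series_add a b) c = series_add (shuffle a c) (shuffle b c).
Proof.
apply/funext => w; rewrite /series_add /shuffle -word_sumD.
apply: eq_word_sum => u _; rewrite -word_sumD; apply: eq_word_sum => v _.
by rewrite !mulrDl.
Qed.

Lemma shuffleC : commutative (@shuffle R).
Proof.
move=> c d; apply/funext => w; elim: w c d => [|i w IH] c d.
  by rewrite !shuffle_nil mulrC.
by rewrite !shuffle_cons addrC; congr (_ + _); rewrite IH.
Qed.

Lemma shuffleDr a b c :
  shuffle a (series_add b c) = series_add (shuffle a b) (shuffle a c).
Proof. by rewrite ![shuffle a _]shuffleC shuffleDl. Qed.

Lemma shuffleA : associative (@shuffle R).
Proof.
move=> a b c; apply/funext => w; elim: w a b c => [|i w IH] a b c.
  by rewrite !shuffle_nil mulrA.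
rewrite !shuffle_cons !lderiv_shuffle shuffleDl shuffleDr /series_add.
by rewrite !IH addrA.
Qed.

Lemma lderiv_series1 i : lderiv i (@series1 R) = series0 R.
Proof. by []. Qed.

Lemma shuffle0 c : shuffle (series0 R) c = series0 R.
Proof.
apply/funext => w; apply: word_sum0 => u _; apply: word_sum0 => v _.
by rewrite !mul0r.
Qed.

Lemma shuffle1 c : shuffle (@series1 R) c = c.
Proof.
apply/funext => w; elim: w c => [|i w IH] c.
  by rewrite shuffle_nil mul1r.
by rewrite shuffle_cons lderiv_series1 shuffle0 IH add0r.
Qed.

Lemma series_addA : associative (@series_add R).
Proof. by move=> a b c; apply/funext => w; rewrite /series_add addrA. Qed.

Lemma series_addC : commutative (@series_add R).
Proof. by move=> a b; apply/funext => w; rewrite /series_add addrC. Qed.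

Lemma series_add0 c : series_add (series0 R) c = c.
Proof. by apply/funext => w; rewrite /series_add add0r. Qed.

End Shuffle.

(** * Composition of series *)

Section Comp.
Variable R : realType.
Implicit Types (a b c : series R) (d e : series2 R) (w : word).

Lemma comp_trunc n c d w : (size w <= n)%N ->
  comp c d w = word_sum n (fun eta => c eta * word_comp eta d w).
Proof.
move=> le_n; rewrite [RHS](word_sum_trunc le_n) // => u lt_u.
by rewrite word_comp_size ?mulr0.
Qed.

Lemma comp_nil c d : comp c d [::] = c [::].
Proof. by rewrite /comp word_sum_nil mulr1. Qed.

(** Shuffling with a fixed series commutes with the infinite sum that defines
    [comp], since at each word only finitely many summands matter. *)
Lemma word_sum_shuffle n (a c : series R) d w : (size w <= n)%N ->
  word_sum n (fun eta => c eta * shuffle a (word_comp eta d) w) =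
  shuffle a (comp c d) w.
Proof.
move=> le_n; rewrite (@shuffle_trunc _ n n) //.
under eq_word_sum => eta _.
  rewrite (@shuffle_trunc _ n n) // -word_sumZ.
  under eq_word_sum => u _ do rewrite -word_sumZ.
  over.
rewrite [LHS]word_sum_exchange; apply: eq_word_sum => u _.
rewrite [LHS]word_sum_exchange; apply: eq_word_sum => v le_v.
rewrite (comp_trunc _ _ le_v) mulrAC -word_sumZ.
by apply: eq_word_sum => eta _; ring.
Qed.

Lemma comp_x1 c d w : comp c d (x1 :: w) = shuffle d.1 (comp (lderiv x1 c) d) w.
Proof.
rewrite /comp /= word_sum_first /= mulr0 add0r word_sum0 ?add0r => [|u _].
  2: by rewrite mulr0.
rewrite -(@word_sum_shuffle (size w)) //; apply: eq_word_sum => u _.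
by rewrite /series_add /= addr0.
Qed.

Lemma comp_x0 c d w : comp c d (x0 :: w) =
  comp (lderiv x0 c) d w + shuffle d.2 (comp (lderiv x1 c) d) w.
Proof.
rewrite /comp /= word_sum_first /= mulr0 add0r; congr (_ + _).
rewrite -(@word_sum_shuffle (size w)) //; apply: eq_word_sum => u _.
by rewrite /series_add /= add0r.
Qed.

Lemma lderiv_comp_x1 c d :
  lderiv x1 (comp c d) = shuffle d.1 (comp (lderiv x1 c) d).
Proof. by apply/funext => w; rewrite /lderiv comp_x1. Qed.

Lemma lderiv_comp_x0 c d : lderiv x0 (comp c d) =
  series_add (comp (lderiv x0 c) d) (shuffle d.2 (comp (lderiv x1 c) d)).
Proof. by apply/funext => w; rewrite /lderiv comp_x0. Qed.

Lemma compD a b d : comp (series_add a b) d = series_add (comp a d) (comp b d).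
Proof.
apply/funext => w; rewrite /series_add /comp -word_sumD.
by apply: eq_word_sum => u _; rewrite mulrDl.
Qed.

Lemma comp0 d : comp (series0 R) d = series0 R.
Proof. by apply/funext => w; apply: word_sum0 => u _; rewrite mul0r. Qed.

Lemma comp_series1 d : comp (@series1 R) d = series1 R.
Proof.
apply/funext => -[|[] w]; first exact: comp_nil.
  by rewrite comp_x1 lderiv_series1 comp0 shuffleC shuffle0.
by rewrite comp_x0 !lderiv_series1 comp0 shuffleC shuffle0 /series0 addr0.
Qed.

Lemma word_size_ind (P : word -> Prop) :
  P [::] ->
  (forall i w, (forall v, (size v <= size w)%N -> P v) -> P (i :: w)) ->
  forall w, P w.
Proof.
move=> P0 PS w; have [n] := ubnP (size w); elim: n w => // n IH [|i w] //.
rewrite ltnS /= => lt_w; apply: PS => v le_v.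
by apply: IH; apply: leq_ltn_trans le_v lt_w.
Qed.

Lemma shuffleCA a b c : shuffle a (shuffle b c) = shuffle b (shuffle a c).
Proof. by rewrite !shuffleA [shuffle a b]shuffleC. Qed.

(** Both sides satisfy the same recursion under left derivatives: the Leibniz
    rule on the left matches, after moving d_1 and d_2 across the commutative
    product, the Leibniz rule on the right. *)
Lemma comp_shuffle a b d :
  comp (shuffle a b) d = shuffle (comp a d) (comp b d).
Proof.
apply/funext => w; elim/word_size_ind: w a b => [|i w IH] a b.
  by rewrite comp_nil !shuffle_nil !comp_nil.
have E s j : shuffle s (comp (lderiv j (shuffle a b)) d) w =
    shuffle s (series_add (shuffle (comp (lderiv j a) d) (comp b d))
                    (shuffle (comp a d) (comp (lderiv j b) d))) w.
  rewrite lderiv_shuffle; apply: (@eq_shuffle _ (size w)) => // v le_v.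
  by rewrite compD /series_add !IH.
rewrite shuffle_cons; case: i.
  rewrite comp_x1 E !lderiv_comp_x1 shuffleDr /series_add.
  by rewrite shuffleA [shuffle _ (shuffle (comp a d) _)]shuffleCA.
rewrite comp_x0 E !lderiv_comp_x0 lderiv_shuffle compD shuffleDl !shuffleDr.
rewrite /series_add !(IH _ (leqnn _)) shuffleA [shuffle _ (shuffle (comp a d) _)]shuffleCA.
exact: addrACA.
Qed.

(** The common unit of [dot] and [star]. *)
Definition unit2 : series2 R := (series1 R, series0 R).

Lemma comp_unit2 c : comp c unit2 = c.
Proof.
apply/funext => w; elim: w c => [|[] w IH] c; first exact: comp_nil.
  by rewrite comp_x1 shuffle1 IH.
by rewrite comp_x0 shuffle0 IH addr0.
Qed.

(** On the left, the derivative by x_1 picks up the factor d_1 ∘~ e from the inner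
    composition and e_1 from the outer one, and their product is the first
    component of d ⋆ e.  The derivative by x_0 collects the terms d_2 ∘~ e and
    e_2 (d_1 ∘~ e), whose sum is the second component. *)
Lemma comp_comp c d e : comp (comp c d) e = comp c (star d e).
Proof.
apply/funext => w; elim/word_size_ind: w c => [|i w IH] c.
  by rewrite !comp_nil.
have E s : shuffle s (comp (comp (lderiv x1 c) d) e) w =
    shuffle s (comp (lderiv x1 c) (star d e)) w.
  by apply: (@eq_shuffle _ (size w)) => // v le_v; rewrite IH.
case: i.
  by rewrite !comp_x1 lderiv_comp_x1 comp_shuffle shuffleA E [shuffle e.1 _]shuffleC.
rewrite !comp_x0 lderiv_comp_x0 lderiv_comp_x1 compD !comp_shuffle.
rewrite {1}/series_add IH // -addrA; congr (_ + _).
by rewrite shuffleA [shuffle e.2 _]shuffleC !E /= shuffleDl.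
Qed.

End Comp.

(** * The two products and the action on G *)

Section Groups.
Variable R : realType.
Implicit Types c d e : series2 R.

Lemma dotA : associative (@dot R).
Proof.
move=> [c1 c2] [d1 d2] [e1 e2]; rewrite /dot /=; congr pair.
  exact: shuffleA.
by rewrite shuffleDr series_addA shuffleA.
Qed.

Lemma dot1 c : dot (unit2 R) c = c.
Proof. by case: c => c1 c2; rewrite /dot /= !shuffle1 series_add0. Qed.

Lemma dotr1 c : dot c (unit2 R) = c.
Proof.
case: c => c1 c2; rewrite /dot /= ![shuffle c1 _]shuffleC shuffle1 shuffle0.
by rewrite series_addC series_add0.
Qed.

Lemma tri_dot c d e : tri (dot c d) e = dot (tri c e) (tri d e).
Proof. by rewrite /tri /dot /= compD !comp_shuffle. Qed.

Lemma tri_tri c d e : tri (tri c d) e = tri c (star d e).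
Proof. by rewrite /tri /= !comp_comp. Qed.

Lemma tri1 d : tri (unit2 R) d = unit2 R.
Proof. by rewrite /tri /= comp_series1 comp0. Qed.

Lemma trir1 c : tri c (unit2 R) = c.
Proof. by case: c => c1 c2; rewrite /tri /= !comp_unit2. Qed.

(** (c ⋆ d) ⋆ e = (((c ◁ d) ◁ e) · (d ◁ e)) · e = (c ◁ (d ⋆ e)) · (d ⋆ e). *)
Lemma starA : associative (@star R).
Proof.
by move=> c d e; rewrite [RHS]/star {1}/star tri_dot -tri_tri -dotA.
Qed.

Lemma star1 c : star (unit2 R) c = c.
Proof. by rewrite /star tri1 dot1. Qed.

Lemma starr1 c : star c (unit2 R) = c.
Proof. by rewrite /star trir1 dotr1. Qed.

Lemma inG1 : inG (unit2 R).
Proof. by []. Qed.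

Lemma inG_dot c d : inG c -> inG d -> inG (dot c d).
Proof. by rewrite /inG /= shuffle_nil => -> ->; rewrite mulr1. Qed.

Lemma inG_tri c d : inG c -> inG (tri c d).
Proof. by rewrite /inG /= comp_nil. Qed.

Lemma inG_star c d : inG c -> inG d -> inG (star c d).
Proof. by move=> Gc Gd; apply: inG_dot => //; apply: inG_tri. Qed.

Definition series_opp (c : series R) : series R := fun w => - c w.

Lemma series_addN (c : series R) : series_add (series_opp c) c = series0 R.
Proof. by apply/funext => w; rewrite /series_add /series_opp addNr. Qed.

Lemma shuffleN a b : shuffle (series_opp a) b = series_opp (shuffle a b).
Proof.
apply/funext => w; have := congr1 (@^~ w) (shuffleDl (series_opp a) a b).
by rewrite series_addN shuffle0 => /esym/addr0_eq e; rewrite /series_opp -e opprK.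
Qed.

Definition shuffle_pow (c : series R) k := iter k (shuffle c) (series1 R).

Lemma shuffle_pow_small (c : series R) k w : c [::] = 0 -> (size w < k)%N ->
  shuffle_pow c k w = 0.
Proof.
move=> c0; elim: k w => // k IH w; rewrite ltnS => le_w /=.
apply: word_sum0 => -[|i u] le_u; apply: word_sum0 => v le_v.
  by rewrite c0 !mul0r.
have [e|ne] := eqVneq (size (i :: u) + size v)%N (size w).
  rewrite (IH v) ?mulr0 ?mul0r //.
  by rewrite (leq_trans _ le_w) // -e /= addSn ltnS leq_addl.
by rewrite count_shuffle_size ?mulr0.
Qed.

(** The geometric series of 1 - c.  For c with constant term 1, the k-th power
    of 1 - c starts in length k, so that the coefficient of w needs only the
    powers up to the length of w. *)
Definition shuffle_inv (c : series R) : series R := fun w =>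
  \sum_(k < (size w).+1) shuffle_pow (series_add (series1 R) (series_opp c)) k w.

Lemma shuffle_inv_trunc (c : series R) n w : c [::] = 1 -> (size w <= n)%N ->
  shuffle_inv c w =
  \sum_(k < n.+1) shuffle_pow (series_add (series1 R) (series_opp c)) k w.
Proof.
move=> c1 le_n; rewrite /shuffle_inv; set s := series_add _ _.
have s0 : s [::] = 0 by rewrite /s /series_add /series_opp c1 subrr.
rewrite -!(big_mkord xpredT (fun k => shuffle_pow s k w)).
rewrite [RHS](@big_cat_nat _ _ _ (size w).+1) //= [X in _ = _ + X]big_nat_cond.
rewrite [X in _ = _ + X]big1 ?addr0 // => k /andP[/andP[lt_k _] _].
exact: shuffle_pow_small.
Qed.

Lemma shuffle_sumr a n (F : nat -> series R) :
  shuffle a (fun w => \sum_(k < n) F k w) =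
  fun w => \sum_(k < n) shuffle a (F k) w.
Proof.
elim: n => [|n IH]; apply/funext => w.
  rewrite big_ord0 -[RHS]/(series0 R w) -(shuffle0 a) shuffleC; congr (shuffle _ a w).
  by apply/funext => v; rewrite big_ord0.
rewrite big_ord_recr /= -[X in _ = X + _](congr1 (@^~ w) IH).
rewrite -[RHS]/(series_add _ _ w) -shuffleDr.
by congr (shuffle a _ w); apply/funext => v; rewrite big_ord_recr.
Qed.

(** Shifting the geometric series by one; the power that drops out at w has
    exponent larger than the length of w. *)
Lemma shuffle_invE (c : series R) : c [::] = 1 ->
  shuffle_inv c = series_add (series1 R)
    (shuffle (series_add (series1 R) (series_opp c)) (shuffle_inv c)).
Proof.
move=> c1; apply/funext => w; pose s := series_add (series1 R) (series_opp c).
have s0 : s [::] = 0 by rewrite /s /series_add /series_opp c1 subrr.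
rewrite -[series_add _ (series_opp c)]/s [RHS]/series_add.
rewrite (@eq_shuffle _ (size w) s s (shuffle_inv c)
  (fun v => \sum_(k < (size w).+1) shuffle_pow s k v)) //; last first.
  by move=> v le_v; apply: shuffle_inv_trunc.
rewrite shuffle_sumr -(@big_ord_recl _ 0 +%R (size w).+1 (fun k => shuffle_pow s k w)).
by rewrite big_ord_recr /= [X in _ + X](@shuffle_pow_small s (size w).+1) ?addr0.
Qed.

Lemma shuffle_invr (c : series R) : c [::] = 1 -> shuffle c (shuffle_inv c) = series1 R.
Proof.
move=> c1; have := shuffle_invE c1; rewrite shuffleDl shuffle1 => e.
apply/funext => w; have := congr1 (@^~ w) e; rewrite shuffleN.
rewrite /series_add /series_opp addrCA -{1}[shuffle_inv c w]addr0.
by move/addrI/esym/eqP; rewrite subr_eq0 => /eqP <-.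
Qed.

(** The inverse (c_1^-1, - c_1^-1 c_2) in the group (G, dot). *)
Definition dot_inv c : series2 R :=
  let i := shuffle_inv c.1 in (i, series_opp (shuffle i c.2)).

Lemma dot_invr c : inG c -> dot c (dot_inv c) = unit2 R.
Proof.
case: c => c1 c2 /= Gc; rewrite /dot /= shuffle_invr //; congr pair.
rewrite [shuffle c1 _]shuffleC shuffleN shuffleC shuffleA shuffle_invr //.
by rewrite shuffle1 series_addC series_addN.
Qed.

Lemma inG_inv c : inG c -> inG (dot_inv c).
Proof.
rewrite /inG /= /shuffle_inv /= => _.
by rewrite big_ord_recl big_ord0 addr0.
Qed.

Lemma dot_invl c : inG c -> dot (dot_inv c) c = unit2 R.
Proof.
move=> Gc; have Gi := inG_inv Gc.
(* With i the right inverse of c and j that of i, c = c (i j) = (c i) j = j. *)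
rewrite -{2}[c]dotr1 -{1}(dot_invr Gi) [dot c _]dotA dot_invr // dot1.
exact: dot_invr.
Qed.

Lemma dot_inv_uniq c d : inG c -> dot c d = unit2 R -> d = dot_inv c.
Proof.
by move=> Gc cd; rewrite -[d]dot1 -(dot_invl Gc) -dotA cd dotr1.
Qed.

Lemma tri_inv c d : inG c -> tri (dot_inv c) d = dot_inv (tri c d).
Proof.
move=> Gc; apply: dot_inv_uniq; first exact: inG_tri.
by rewrite -tri_dot dot_invr // tri1.
Qed.

End Groups.

Local Open Scope tensor_scope.

(** * Evaluating tensors at pairs of linear functionals *)

Section LinearMaps.
Variables (R : comNzRingType).
Implicit Types U V W : lmodType R.

Section Def.
Variables (V U : lmodType R) (f : V -> U).
Hypothesis fL : linear f.

Lemma linD x y : f (x + y) = f x + f y.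
Proof. by have := fL 1 x y; rewrite !scale1r. Qed.

Lemma lin0 : f 0 = 0.
Proof. by apply: (addrI (f 0)); rewrite -linD !addr0. Qed.

Lemma linZ a x : f (a *: x) = a *: f x.
Proof. by have := fL a x 0; rewrite lin0 !addr0. Qed.

End Def.

Lemma linear_comp U V W (f : V -> W) (g : U -> V) :
  linear f -> linear g -> linear (f \o g).
Proof. by move=> fL gL a x y /=; rewrite gL fL. Qed.

End LinearMaps.

Section TensorEval.
Variables (R : comNzRingType).
Implicit Types U V W : lmodType R.

(** [tlift] is linear in the function as well, bilinear or not, because it
    always expands the same representative of the tensor. *)
Lemma tlift_linearf V W U (f g h : V -> W -> U) a t :
  (forall v w, h v w = a *: f v w + g v w) ->
  tlift h t = a *: tlift f t + tlift g t.
Proof.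
move=> hE; rewrite /tlift scaler_sumr -big_split; apply: eq_bigr => p _ /=.
by rewrite hE scalerDr !scalerA mulrC.
Qed.

Lemma eq_tlift V W U (f g : V -> W -> U) t :
  (forall v w, f v w = g v w) -> tlift f t = tlift g t.
Proof. by move=> fg; apply: eq_bigr => p _; rewrite fg. Qed.

Lemma tensor_eq V W U (F G : tensor V W -> U) : linear F -> linear G ->
  (forall v w, F (v ⊗ w) = G (v ⊗ w)) -> forall t, F t = G t.
Proof.
move=> FL GL FG; elim/tensor_ind => [|a v w t IH]; first by rewrite !lin0.
by rewrite FL GL FG IH.
Qed.

Lemma tens_sum V W (t : tensor V W) :
  exists s : seq (V * W), t = \sum_(p <- s) p.1 ⊗ p.2.
Proof.
elim/tensor_ind: t => [|a v w t [s ->]]; first by exists [::]; rewrite big_nil.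
exists ((a *: v, w) :: s); rewrite big_cons /=; congr (_ + _).
by rewrite (linZ ((@tens_bilinear R V W).1 w)).
Qed.

Lemma tensBl V W a (x y : V) (z : W) : (x - a *: y) ⊗ z = x ⊗ z - a *: (y ⊗ z).
Proof. by rewrite addrC -scaleNr (tens_bilinear V W).1 scaleNr addrC. Qed.

Lemma tensPr V W a (z : V) (x y : W) : z ⊗ (a *: x + y) = a *: (z ⊗ x) + z ⊗ y.
Proof. exact: (tens_bilinear V W).2. Qed.

Lemma tensNr V W (z : V) (x : W) : z ⊗ (- x) = - (z ⊗ x).
Proof. by rewrite -scaleN1r (linZ ((tens_bilinear V W).2 z)) scaleN1r. Qed.

Lemma tmap_bilinear V V' W W' (f : V -> V') (g : W -> W') :
  linear f -> linear g -> is_bilinear (fun v w => f v ⊗ g w).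
Proof.
move=> fL gL; have [tl tr] := tens_bilinear V' W'.
by split=> [w a x y|v a x y]; rewrite ?fL ?gL ?tl ?tr.
Qed.

Lemma tmap_linear V V' W W' (f : V -> V') (g : W -> W') :
  linear f -> linear g -> linear (tmap f g).
Proof. by move=> fL gL; apply: tlift_linear; apply: tmap_bilinear. Qed.

Lemma tmapE V V' W W' (f : V -> V') (g : W -> W') v w :
  linear f -> linear g -> tmap f g (v ⊗ w) = f v ⊗ g w.
Proof. by move=> fL gL; rewrite [LHS]tliftE //; apply: tmap_bilinear. Qed.

(** The shape shared by [tens_mul] and [tens_coaction]: a map of four
    arguments lifted to a pair of tensors. *)
Lemma tlift2_bilinear (V A W B U : lmodType R) (F : V -> A -> W -> B -> U) :
  (forall v a, is_bilinear (F v a)) ->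
  (forall w b, is_bilinear (fun v a => F v a w b)) ->
  is_bilinear (fun p q => tlift (fun v a => tlift (F v a) q) p).
Proof.
move=> F1 F2; have F3 q : is_bilinear (fun v a => tlift (F v a) q).
  split=> [a k v v'|v k a a']; apply: tlift_linearf => w b.
    exact: (F2 w b).1.
  exact: (F2 w b).2.
split=> [q|p k q q']; first exact: tlift_linear.
by apply: tlift_linearf => v a; apply: tlift_linear.
Qed.

Lemma tlift2E (V A W B U : lmodType R) (F : V -> A -> W -> B -> U) v a w b :
  (forall v a, is_bilinear (F v a)) ->
  (forall w b, is_bilinear (fun v a => F v a w b)) ->
  tlift (fun v a => tlift (F v a) (w ⊗ b)) (v ⊗ a) = F v a w b.
Proof.
move=> F1 F2; rewrite tliftE ?tliftE //.
split=> [{}a k {}v v'|{}v k {}a a']; rewrite !tliftE //.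
  exact: (F2 w b).1.
exact: (F2 w b).2.
Qed.

Definition tens_ev V W (f : V -> R^o) (g : W -> R^o) : tensor V W -> R^o :=
  tlift (fun v w => (f v * g w : R^o)).

Lemma eq_tens_ev V W (f f' : V -> R^o) (g g' : W -> R^o) t :
  f =1 f' -> g =1 g' -> tens_ev f g t = tens_ev f' g' t.
Proof. by move=> ff gg; apply: eq_tlift => v w; rewrite ff gg. Qed.

Lemma functional_mul_bilinear V W (f : V -> R^o) (g : W -> R^o) :
  linear f -> linear g -> is_bilinear (fun v w => (f v * g w : R^o)).
Proof.
move=> fL gL; split=> [w a x y|v a x y].
  by rewrite fL mulrDl scalerAl.
by rewrite gL mulrDr scalerAr.
Qed.

Section Ev.
Variables (V W : lmodType R) (f : V -> R^o) (g : W -> R^o).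
Hypotheses (fL : linear f) (gL : linear g).

Lemma tens_ev_linear : linear (tens_ev f g).
Proof. by apply: tlift_linear; apply: functional_mul_bilinear. Qed.

Lemma tens_evE v w : tens_ev f g (v ⊗ w) = f v * g w.
Proof. by rewrite /tens_ev tliftE //; apply: functional_mul_bilinear. Qed.

Lemma tens_ev_tmap V' W' (p : V' -> V) (q : W' -> W) t :
  linear p -> linear q ->
  tens_ev f g (tmap p q t) = tens_ev (f \o p) (g \o q) t.
Proof.
move=> pL qL; have fpL := linear_comp fL pL; have gqL := linear_comp gL qL.
have B := functional_mul_bilinear fpL gqL.
move: t; apply: (tensor_eq (U := R^o)) => [||v w].
- exact: linear_comp tens_ev_linear (tmap_linear pL qL).
- exact: tlift_linear.
by rewrite /= tmapE // tens_evE // [RHS]tliftE.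
Qed.

End Ev.

Lemma tassoc_bilinear U V W : is_bilinear
  (fun (t : tensor U V) (w : W) => tlift (fun u v => u ⊗ (v ⊗ w)) t).
Proof.
have [tl1 tr1] := tens_bilinear U (tensor V W).
have [tl2 tr2] := tens_bilinear V W.
split=> [w|t a w w'].
  by apply: tlift_linear; split=> [v|u a v v']; rewrite ?tl2 ?tr1 //; apply: tl1.
by apply: tlift_linearf => u v; rewrite tr2 tr1.
Qed.

Lemma tens_ev_tassoc U V W (f : U -> R^o) (g : V -> R^o) (h : W -> R^o) t :
  linear f -> linear g -> linear h ->
  tens_ev f (tens_ev g h) (tassoc t) = tens_ev (tens_ev f g) h t.
Proof.
move=> fL gL hL; have ghL := tens_ev_linear gL hL; have fgL := tens_ev_linear fL gL.
have fghL := tens_ev_linear fL ghL.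
move: t; apply: (tensor_eq (U := R^o)) => [||t w].
- by apply: linear_comp fghL _; apply: tlift_linear; apply: tassoc_bilinear.
- exact: tens_ev_linear.
rewrite /= /tassoc tliftE; last exact: tassoc_bilinear.
rewrite [RHS]tens_evE //; move: t.
have B : is_bilinear (fun (u : U) (v : V) => u ⊗ (v ⊗ w)).
  have [tl1 tr1] := tens_bilinear U (tensor V W).
  have [tl2 tr2] := tens_bilinear V W.
  by split=> [v|u a v v']; rewrite ?tl2 ?tr1 //; apply: tl1.
apply: (tensor_eq (U := R^o)) => [||u v].
- by apply: linear_comp fghL _; apply: tlift_linear.
- by move=> a x y; rewrite fgL mulrDl scalerAl.
by rewrite tliftE // !tens_evE // mulrA.
Qed.

Lemma ev_tunitl V (f : V -> R^o) t : linear f ->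
  f (tunitl t) = tens_ev id f t.
Proof.
move=> fL; have B : is_bilinear (fun (r : R^o) (v : V) => r *: v).
  split=> [v a r s|r a v w]; first by rewrite scalerDl scalerA.
  by rewrite scalerDr !scalerA mulrC.
move: t; apply: (tensor_eq (U := R^o)) => [||r v].
- by apply: linear_comp fL _; apply: tlift_linear.
- exact: tens_ev_linear.
by rewrite /tunitl tliftE // tens_evE // linZ.
Qed.

Lemma ev_tunitr V (f : V -> R^o) t : linear f ->
  f (tunitr t) = tens_ev f id t.
Proof.
move=> fL; have B : is_bilinear (fun (v : V) (r : R^o) => r *: v).
  split=> [v a r s|r a v w]; last by rewrite scalerDl scalerA.
  by rewrite scalerDr !scalerA mulrC.
move: t; apply: (tensor_eq (U := R^o)) => [||v r].
- by apply: linear_comp fL _; apply: tlift_linear.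
- exact: tens_ev_linear.
by rewrite /tunitr tliftE // tens_evE // linZ // mulrC.
Qed.

Section Algebras.
Variables A B : algType R.

Lemma mul_bilinear : is_bilinear (@GRing.mul A).
Proof.
split=> [w a x y|v a x y]; first by rewrite mulrDl scalerAl.
by rewrite mulrDr scalerAr.
Qed.

Lemma tmul_linear : linear (@tmul R A).
Proof. by apply: tlift_linear; apply: mul_bilinear. Qed.

Lemma ev_tmul (f : A -> R^o) t : linear f -> {morph f : x y / x * y} ->
  f (tmul t) = tens_ev f f t.
Proof.
move=> fL fM; move: t; apply: (tensor_eq (U := R^o)) => [||x y].
- exact: linear_comp fL tmul_linear.
- exact: tens_ev_linear.
by rewrite /tmul tliftE ?tens_evE //; apply: mul_bilinear.
Qed.

Let tens_mul_bilinear1 (a : A) (b : B) :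
  is_bilinear (fun a' b' => (a * a') ⊗ (b * b')).
Proof.
have [tl tr] := tens_bilinear A B; have [ml mr] := mul_bilinear.
split=> [b' k x y|a' k x y]; first by rewrite mulrDr -scalerAr tl.
by rewrite mulrDr -scalerAr tr.
Qed.

Let tens_mul_bilinear2 (a' : A) (b' : B) :
  is_bilinear (fun a b => (a * a') ⊗ (b * b')).
Proof.
have [tl tr] := tens_bilinear A B.
split=> [b k x y|a k x y]; first by rewrite mulrDl -scalerAl tl.
by rewrite mulrDl -scalerAl tr.
Qed.

Lemma tens_mul_bilinear : is_bilinear (@tens_mul R A B).
Proof.
exact: (tlift2_bilinear (F := fun a b a' b' => (a * a') ⊗ (b * b'))).
Qed.

Lemma tens_ev_mul (f : A -> R^o) (g : B -> R^o) s t :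
  linear f -> linear g -> {morph f : x y / x * y} -> {morph g : x y / x * y} ->
  tens_ev f g (tens_mul s t) = tens_ev f g s * tens_ev f g t.
Proof.
move=> fL gL fM gM; have eL := tens_ev_linear fL gL.
have [ml mr] := tens_mul_bilinear.
move: s; apply: (tensor_eq (U := R^o)).
- by apply: linear_comp eL _; apply: ml.
- by move=> a x y; rewrite eL mulrDl scalerAl.
move=> a b; move: t; apply: (tensor_eq (U := R^o)).
- by apply: linear_comp eL _; apply: mr.
- by move=> k x y; rewrite eL mulrDr scalerAr.
move=> a' b'; rewrite /= /tens_mul.
rewrite (tlift2E (F := fun a b a' b' => (a * a') ⊗ (b * b'))) //.
by rewrite !tens_evE // fM gM mulrACA.
Qed.

End Algebras.

Section Coaction.
Variables (C : comAlgType R) (V W : lmodType R).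
Variables (rV : V -> tensor V C) (rW : W -> tensor W C).
Hypotheses (rVL : linear rV) (rWL : linear rW).

Let F (v : V) (a : C) (w : W) (b : C) : tensor (tensor V W) C := (v ⊗ w) ⊗ (a * b).

Let F1 v a : is_bilinear (F v a).
Proof.
have [tl1 tr1] := tens_bilinear V W; have [tl2 tr2] := tens_bilinear (tensor V W) C.
split=> [b k x y|w k x y]; rewrite /F ?tr1 ?tl2 //.
by rewrite mulrDr -scalerAr tr2.
Qed.

Let F2 w b : is_bilinear (fun v a => F v a w b).
Proof.
have [tl1 tr1] := tens_bilinear V W; have [tl2 tr2] := tens_bilinear (tensor V W) C.
split=> [a k x y|v k x y]; rewrite /F ?tl1 ?tl2 //.
by rewrite mulrDl -scalerAl tr2.
Qed.

Lemma tens_coaction_linear : linear (tens_coaction rV rW).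
Proof.
apply: linear_comp (tmap_linear rVL rWL).
by apply: tlift_linear; apply: (tlift2_bilinear F1 F2).
Qed.

Lemma tens_ev_coaction (f : V -> R^o) (g : W -> R^o) (h : C -> R^o) t :
  linear f -> linear g -> linear h -> {morph h : x y / x * y} ->
  tens_ev (tens_ev f g) h (tens_coaction rV rW t) =
  tens_ev (tens_ev f h \o rV) (tens_ev g h \o rW) t.
Proof.
move=> fL gL hL hM; have fgL := tens_ev_linear fL gL.
have fhL := tens_ev_linear fL hL; have ghL := tens_ev_linear gL hL.
have eL := tens_ev_linear fgL hL.
have BB := tlift2_bilinear F1 F2.
move: t; apply: (tensor_eq (U := R^o)) => [||v w].
- exact: linear_comp eL tens_coaction_linear.
- by apply: tens_ev_linear; apply: linear_comp.
rewrite [RHS]tens_evE; [|exact: linear_comp|exact: linear_comp].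
rewrite /= /tens_coaction tmapE // (tliftE BB).
move: (rV v) (rW w) => p q.
move: p; apply: (tensor_eq (U := R^o)).
- by apply: linear_comp eL _; apply: BB.1.
- by move=> a x y; rewrite fhL mulrDl scalerAl.
move=> {}v a; move: q; apply: (tensor_eq (U := R^o)).
- by apply: linear_comp eL _; apply: BB.2.
- by move=> k x y; rewrite ghL mulrDr scalerAr.
move=> {}w b; rewrite /= (tlift2E _ _ _ _ F1 F2) /F !tens_evE //.
by rewrite hM mulrACA.
Qed.

End Coaction.

End TensorEval.

(** * Separating families of functionals *)

Section Separation.
Variable R : fieldType.
Implicit Types V W : lmodType R.

Definition separating V (E : (V -> R^o) -> Prop) : Prop :=
  (forall f, E f -> linear f) /\ (forall x, (forall f, E f -> f x = 0) -> x = 0).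

Lemma separating_eq V (E : (V -> R^o) -> Prop) x y : separating E ->
  (forall f, E f -> f x = f y) -> x = y.
Proof.
move=> [EL E0] exy; apply/eqP; rewrite -subr_eq0; apply/eqP/E0 => f Ef.
have fL := EL f Ef; rewrite addrC -scaleN1r fL exy //.
by rewrite scaleN1r addNr.
Qed.

Lemma separating_id : separating (fun f : R^o -> R^o => f = id).
Proof. by split=> [f ->|x /(_ id erefl)]. Qed.

(** For t = sum_i v_i ⊗ w_i killed by all f ⊗ g, induction on the number of
    terms.  If some f has f(v_0) <> 0, then sum_i f(v_i) w_i is killed by all g,
    hence zero; this expresses w_0 through the other w_i and rewrites t
    with one term less. *)
Lemma separating_tens V W (E : (V -> R^o) -> Prop) (F : (W -> R^o) -> Prop) :
  separating E -> separating F ->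
  separating (fun h => exists f g, [/\ E f, F g & h = tens_ev f g]).
Proof.
move=> [EL E0] [FL F0]; split=> [_ [f] [g] [Ef Fg ->]|t].
  by apply: tens_ev_linear; [apply: EL | apply: FL].
have [tl tr] := tens_bilinear V W.
have [s {t}->] := tens_sum t => ht.
have {ht} : forall f g, E f -> F g -> \sum_(p <- s) f p.1 * g p.2 = 0.
  move=> f g Ef Fg; have fL := EL f Ef; have gL := FL g Fg.
  rewrite -[RHS](ht _ (ex_intro _ f (ex_intro _ g (And3 Ef Fg erefl)))).
  have eL := tens_ev_linear fL gL.
  elim: s {ht} => [|p s IH]; first by rewrite !big_nil lin0.
  by rewrite !big_cons linD // tens_evE // IH.
have [n] := ubnP (size s); elim: n s => // n IH [|[v w] s]; first by rewrite big_nil.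
rewrite ltnS /= => lt_s hs.
have [v0|/eqP v0] := eqVneq v 0.
  rewrite big_cons v0 (lin0 (tl w)) add0r; apply: IH => // f g Ef Fg.
  by rewrite -[RHS](hs f g Ef Fg) big_cons v0 /= (lin0 (EL f Ef)) mul0r add0r.
have [f Ef fv] : exists2 f, E f & f v != 0.
  apply: contrapT => nf; apply: v0; apply: E0 => f Ef; apply/eqP; apply: contrapT => /negP fv.
  by apply: nf; exists f.
have fL := EL f Ef.
have w0 : f v *: w + \sum_(p <- s) f p.1 *: p.2 = 0.
  apply: F0 => g Fg; have gL := FL g Fg.
  rewrite -[RHS](hs f g Ef Fg) big_cons linD // linZ //; congr (_ + _).
  elim: s {hs lt_s} => [|p s IHs]; first by rewrite !big_nil lin0.
  by rewrite !big_cons linD // linZ // IHs.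
pose k (p : V * W) : R := (f p.1 : R) / (f v : R).
have kE p : f p.1 = f v * k p by rewrite /k mulrCA divff // mulr1.
pose r p := (p.1 - k p *: v, p.2) : V * W.
have wE : w = - \sum_(p <- s) k p *: p.2.
  apply: (scalerI fv); move/eqP: w0; rewrite addr_eq0 => /eqP ->.
  rewrite scalerN scaler_sumr; congr (- _); apply: eq_bigr => p _.
  by rewrite kE scalerA.
have -> : \sum_(p <- (v, w) :: s) p.1 ⊗ p.2 = \sum_(p <- map r s) p.1 ⊗ p.2.
  rewrite big_cons big_map /=.
  under [RHS]eq_bigr => p _ do rewrite tensBl.
  rewrite big_split /= sumrN addrC; congr (_ + _).
  rewrite wE tensNr; congr (- _).
  elim: s {hs lt_s wE w0} => [|p s IHs]; first by rewrite !big_nil (lin0 (tr v)).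
  by rewrite !big_cons tensPr IHs.
apply: IH => [|f' g Ef' Fg]; first by rewrite size_map.
have f'L := EL f' Ef'; have gL := FL g Fg.
rewrite -[RHS](hs f' g Ef' Fg) big_cons big_map /= addrC.
have -> : g w = - \sum_(p <- s) k p * g p.2.
  rewrite {1}wE -scaleN1r linZ //= -[LHS]/(-1 * _) mulN1r; congr (- _).
  elim: s {hs lt_s wE w0} => [|p s IHs]; first by rewrite !big_nil lin0.
  by rewrite !big_cons linD // linZ // IHs.
rewrite mulrN mulr_sumr -sumrB; apply: eq_bigr => p _.
by rewrite addrC -scaleNr f'L -[_ *: _]/(_ * _); ring.
Qed.

End Separation.


(** * Points of G separate H *)

Section Dedekind.
Variables (F : fieldType) (M : Type) (mul : M -> M -> M) (one : M).
Variables (I : eqType) (chi : I -> M -> F).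
Hypothesis chi1 : forall i, chi i one = 1.
Hypothesis chiM : forall i x y, chi i (mul x y) = chi i x * chi i y.

(** Multiplying the relation by chi_0(y), and subtracting it from the relation
    translated by y, removes the term of chi_0 and multiplies the coefficient of
    chi_j by chi_j(y) - chi_0(y). *)
Lemma dedekind (s : seq I) (a : I -> F) : uniq s ->
  {in s &, forall i j, i != j -> exists x, chi i x != chi j x} ->
  (forall x, \sum_(i <- s) a i * chi i x = 0) -> {in s, forall i, a i = 0}.
Proof.
elim: s a => // i s IH a /= /andP[i_s us] ne sum0.
have a0 j : j \in s -> a j = 0.
  move=> js; have ij : i != j by apply: contraNneq i_s => ->.
  have js' : j \in i :: s by rewrite inE js orbT.
  have [y chi_y] := ne i j (mem_head i s) js' ij.
  have /eqP : a j * (chi j y - chi i y) = 0.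
    apply: (IH (fun j => a j * (chi j y - chi i y))) => // [k l ks ls|x].
      by apply: ne; rewrite inE ?ks ?ls orbT.
    have : \sum_(k <- i :: s) a k * chi k (mul y x) -
        chi i y * \sum_(k <- i :: s) a k * chi k x = 0.
      by rewrite !sum0 mulr0 subr0.
    rewrite mulr_sumr -sumrB big_cons chiM (_ : _ - _ = 0) ?add0r => [e|]; last by ring.
    by rewrite -[RHS]e; apply: eq_bigr => k _; rewrite chiM; ring.
  by rewrite mulf_eq0 subr_eq0 [chi j y == _]eq_sym (negPf chi_y) orbF => /eqP.
move=> j; rewrite inE => /predU1P[->|/a0 //].
have := sum0 one; rewrite big_cons chi1 mulr1 big_seq big1 ?addr0 // => k ks.
by rewrite a0 // mul0r.
Qed.

End Dedekind.

Local Notation "1" := (@mone _) : monom_scope.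
Local Notation "x * y" := (mmul x y) : monom_scope.

Lemma malgUE (R : nzRingType) (K : choiceType) (a : R) (k : K) :
  << a *g k >> = a *: << k >> :> {malg R[K]}.
Proof. by apply/malgP=> l; rewrite mcoeffZ !mcoeffU mulrnAr mulr1. Qed.

Section CoordinateFunctions.
Variable R : realType.
Implicit Types (c d : series2 R) (m : {cmonom coord_index}) (x y : Halg R).

Lemma cmonom_ind (P : {cmonom coord_index} -> Prop) :
  P 1%M -> (forall g m, P m -> P (ucm g * m)%M) -> forall m, P m.
Proof.
move=> P1 PM m; have [n] := ubnP (mdeg m); elim: n m => // n IH m.
rewrite ltnS => le_m; have [->//|] := eqVneq m 1%M.
move=> m1; have [g mg] : exists g, m g != 0%N.
  apply: contrapT => ng; move/negP: m1; apply; apply/cmP => g; rewrite cm1.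
  by apply/eqP; apply: contrapT => /negP mg; apply: ng; exists g.
have mE : m = (ucm g * divcm m (ucm g))%M.
  apply/eqP/cmP => h; rewrite cmM divcmE cmU; case: eqVneq => [<-|_].
    by rewrite subnKC // lt0n.
  by rewrite subn0 add0n.
rewrite mE; apply: PM; apply: IH; apply: leq_trans le_m.
by rewrite [in X in (_ < X)%N]mE mdegM mdegU.
Qed.

Definition mon m : Halg R := Hpi (<< m >> : symalg R).

Lemma mon1 : mon 1%M = 1.
Proof. exact: Hpi1. Qed.

Lemma monM g m : mon (ucm g * m)%M = gen R g * mon m.
Proof.
by rewrite /mon /gen -HpiM /symgen malgM_def fgmulUU mulr1.
Qed.

Lemma mon_lin_ind (P : Halg R -> Prop) :
  P 0 -> (forall a m x, P x -> P (a *: mon m + x)) -> forall x, P x.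
Proof.
move=> P0 PD x; rewrite -[x]HpiK; move: (Hrepr x) => {x} p.
rewrite [p]monalgE; elim: (enum_fset _) => [|m s].
  by rewrite big_nil (_ : Hpi 0 = 0) //; apply: rmorph0.
rewrite big_cons HpiD.
set q := bigop.body _ _ _.
move: (Hpi q) => x.
rewrite (_ : << p@_m *g m >> = p@_m *: << m >>).
  move=> IHs.
  have e : Hpi (p@_m *: (<< m >> : symalg R)) = p@_m *: mon m.
    exact: (HpiZ p@_m (<< m >> : symalg R)).
  rewrite e.
  exact: PD.
exact: malgUE.
Qed.

Lemma Halg_ind (P : Halg R -> Prop) :
  P 1 -> (forall a x y, P x -> P y -> P (a *: x + y)) ->
  (forall g x, P x -> P (gen R g * x)) -> forall x, P x.
Proof.
move=> P1 PD PM x.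
have P0 : P 0 by rewrite -(addNr 1) -scaleN1r; apply: PD.
elim/mon_lin_ind: x => // a m x Px; apply: (PD) => // {x Px}.
elim/cmonom_ind: m => [|g m Pm]; first by rewrite mon1.
by rewrite monM; apply: PM.
Qed.

Section Eval.
Variable c : series2 R.
Hypothesis Gc : inG c.

Lemma Heval_linear : linear (Heval c).
Proof.
move=> a u v; rewrite -[u]HpiK -[v]HpiK -HpiZ -HpiD.
by rewrite !(Heval_pi _ Gc) symevalP.
Qed.

Lemma HevalM : {morph Heval c : x y / x * y}.
Proof.
move=> u v; rewrite -[u]HpiK -[v]HpiK -HpiM.
by rewrite !(Heval_pi _ Gc) symevalM.
Qed.

Lemma Heval1 : Heval c 1 = 1.
Proof. by rewrite -Hpi1 (Heval_pi _ Gc) symeval1. Qed.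

End Eval.

(** The variable 1 epsilon_1 is constant on G, so monomials that differ by it
    define the same function on G; reduced monomials avoid it. *)
Definition reduced m := m (inl [::]) = 0%N.

Lemma mon_reduced m : exists2 m', reduced m' & mon m = mon m'.
Proof.
elim/cmonom_ind: m => [|g m [m' rm' e]].
  by exists 1%M; first exact: cm1.
have [->|g0] := eqVneq g (inl [::]).
  by exists m'; [exact: rm' | rewrite monM gen_unit mul1r].
exists (ucm g * m')%M; last by rewrite !monM e.
by rewrite /reduced cmM rm' cmU (negPf g0).
Qed.

Lemma Halg_reduced x : exists2 p : symalg R,
  (forall m, p@_m != 0 -> reduced m) & x = Hpi p.
Proof.
elim/mon_lin_ind: x => [|a m x [p rp ->]].
  exists 0; first by move=> m; rewrite mcoeff0 eqxx.
  by apply/esym; apply: rmorph0.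
have [m' rm' ->] := mon_reduced m.
exists (a *: << m' >> + p); last by rewrite HpiD HpiZ.
move=> k; rewrite mcoeffD mcoeffZ mcoeffU1; have [<- _|_] := eqVneq m' k.
  exact: rm'.
by rewrite mulr0 add0r; apply: rp.
Qed.

(** Assigns arbitrary values to all coordinates but 1 epsilon_1. *)
Definition point (h : coord_index -> R) : series2 R :=
  (fun w => if w == [::] then 1 else h (inl w), fun w => h (inr w)).

Lemma inG_point h : inG (point h).
Proof. by []. Qed.

Lemma monom_eval_pointM m h h' : monom_eval (point (fun g => h g * h' g)) m =
  monom_eval (point h) m * monom_eval (point h') m.
Proof.
rewrite /monom_eval -big_split; apply: eq_bigr => -[u|u] _ /=; rewrite -exprMn //.
by case: ifP; rewrite ?mulr1.
Qed.

Lemma monom_eval_point1 m : monom_eval (point (fun=> 1)) m = 1.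
Proof.
by apply: big1 => -[u|u] _ /=; rewrite ?if_same expr1n.
Qed.

(** The points that tell reduced monomials apart. *)
Lemma monom_eval_point2 m g : g != inl [::] ->
  monom_eval (point (fun g' => if g' == g then 2 else 1)) m = 2 ^+ m g.
Proof.
move=> g0; set h := fun=> _.
have hE g' : coord (point h) g' = if g' == g then 2 else 1.
  case: g' => [u|u] //=; case: eqVneq => [->|//].
  by rewrite eq_sym (negPf g0).
rewrite /monom_eval; have [gm|gm] := boolP (g \in finsupp m).
  rewrite (bigD1_seq g gm) ?fset_uniq // hE eqxx big1 => [|g' ne]; first exact: mulr1.
  by rewrite hE (negPf ne) expr1n.
move: (gm); rewrite -cmE_eq0 => /eqP ->; rewrite big_seq big1 // => g' g'm.
by rewrite hE; case: eqVneq => [e|_]; [rewrite -e g'm in gm | rewrite expr1n].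
Qed.

(** A reduced polynomial vanishing at all points is a linear relation between
    pairwise distinct characters of the monoid of points. *)
Lemma separating_Heval : separating (fun f : Halg R -> R^o =>
  exists2 c, inG c & f = @Heval R c).
Proof.
split=> [_ [c Gc ->]|x x0]; first exact: Heval_linear.
have [p rp xE] := Halg_reduced x.
suff p0 m : m \in msupp p -> p@_m = 0.
  rewrite xE (_ : p = 0); first by apply: rmorph0.
  apply/malgP => m; rewrite mcoeff0; have [/p0 //|] := boolP (m \in msupp p).
  exact: mcoeff_outdom.
move: m; apply: (@dedekind _ _ (fun h h' g => h g * h' g) (fun=> 1) _
  (fun m h => monom_eval (point h) m)) => //.
- exact: monom_eval_point1.
- by move=> m h h'; apply: monom_eval_pointM.
- exact: fset_uniq.
- move=> m m' mp m'p ne.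
  have rd k : k \in msupp p -> reduced k by rewrite -mcoeff_neq0; apply: rp.
  have [g gne] : exists g, m g != m' g.
    apply: contrapT => ng; move/negP: ne; apply; apply/cmP => g.
    by apply/eqP; apply: contrapT => /negP mg; apply: ng; exists g.
  have g0 : g != inl [::] by apply: contraNneq gne => ->; rewrite !rd.
  exists (fun g' => if g' == g then 2 else 1); rewrite !monom_eval_point2 //.
  by apply: contra gne => /eqP/ieexprIn -> //; rewrite ?ltr0n // (eqr_nat _ 2 1).
move=> h; rewrite -[RHS](x0 (Heval (point h))); last by exists (point h).
by rewrite xE (Heval_pi _ (inG_point h)) /symeval mmapE.
Qed.

End CoordinateFunctions.

(** * Series with polynomial coefficients *)

(** The functions on X belonging to an algebra A of functions, whose members
    matter only on D.  The two instances below are the functions on G that come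
    from H and the functions on G * G that come from the tensor square. *)
Section PolynomialFunctions.
Variables (R : realType) (X : Type) (D : X -> Prop) (A : (X -> R) -> Prop).
Hypothesis A_ext : forall F G, (forall x, D x -> F x = G x) -> A F -> A G.
Hypothesis A_const : forall a, A (fun=> a).
Hypothesis A_add : forall F G, A F -> A G -> A (fun x => F x + G x).
Hypothesis A_mul : forall F G, A F -> A G -> A (fun x => F x * G x).

Definition polynomial (c : X -> series R) := forall w, A (fun x => c x w).

Lemma A_sum (I : Type) (s : seq I) (F : I -> X -> R) :
  (forall i, A (F i)) -> A (fun x => \sum_(i <- s) F i x).
Proof.
move=> AF; elim: s => [|i s IH].
  by apply: A_ext (A_const 0) => x _; rewrite big_nil.
by apply: A_ext (A_add (AF i) IH) => x _; rewrite big_cons.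
Qed.

Lemma A_word_sum n (F : word -> X -> R) :
  (forall u, A (F u)) -> A (fun x => word_sum n (fun u => F u x)).
Proof. by move=> AF; apply: A_sum => k; apply: A_sum => u; apply: AF. Qed.

Lemma polynomial_const (c : series R) : polynomial (fun=> c).
Proof. by move=> w; apply: A_const. Qed.

Lemma polynomial_add c d : polynomial c -> polynomial d ->
  polynomial (fun x => series_add (c x) (d x)).
Proof. by move=> pc pd w; apply: A_add. Qed.

Lemma polynomial_opp c : polynomial c -> polynomial (fun x => series_opp (c x)).
Proof.
by move=> pc w; apply: A_ext (A_mul (A_const (-1)) (pc w)) => x _; rewrite mulN1r.
Qed.

Lemma polynomial_shuffle c d : polynomial c -> polynomial d ->
  polynomial (fun x => shuffle (c x) (d x)).
Proof.
by move=> pc pd w; do 2!apply: A_word_sum => ?; do 2!apply: A_mul => //.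
Qed.

Lemma polynomial_lconcat i c : polynomial c -> polynomial (fun x => lconcat i (c x)).
Proof.
move=> pc [|j w] /=; first exact: A_const.
by case: (j == i) => //; apply: A_const.
Qed.

Lemma polynomial_word_comp eta (d : X -> series2 R) :
  polynomial (fun x => (d x).1) -> polynomial (fun x => (d x).2) ->
  polynomial (fun x => word_comp eta (d x)).
Proof.
move=> pd1 pd2; elim: eta => [|i eta IH] /=; first exact: polynomial_const.
case: (i == x0); first exact: polynomial_lconcat.
by apply: polynomial_add; apply: polynomial_lconcat; apply: polynomial_shuffle.
Qed.

Lemma polynomial_comp c (d : X -> series2 R) : polynomial c ->
  polynomial (fun x => (d x).1) -> polynomial (fun x => (d x).2) ->
  polynomial (fun x => comp (c x) (d x)).
Proof.
move=> pc pd1 pd2 w; apply: A_word_sum => eta.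
by apply: A_mul => //; apply: polynomial_word_comp.
Qed.

Lemma polynomial_pow c n :
  polynomial c -> polynomial (fun x => shuffle_pow (c x) n).
Proof.
move=> pc; elim: n => [|n IH]; first exact: polynomial_const.
exact: (polynomial_shuffle pc IH).
Qed.

Lemma polynomial_inv c : polynomial c -> polynomial (fun x => shuffle_inv (c x)).
Proof.
move=> pc w; apply: A_sum => k; apply: polynomial_pow.
apply: polynomial_add; first exact: polynomial_const.
exact: polynomial_opp.
Qed.

(** An element of H is a polynomial in finitely many coordinates, so its
    composite with a map whose coordinates lie in A lies in A. *)
Lemma polynomial_Heval (op : X -> series2 R) : (forall x, D x -> inG (op x)) ->
  polynomial (fun x => (op x).1) -> polynomial (fun x => (op x).2) ->
  forall y, A (fun x => Heval (op x) y).
Proof.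
move=> Gop p1 p2 y; elim/Halg_ind: y => [|a y z Ay Az|g y Ay].
- by apply: A_ext (A_const 1) => x Dx; rewrite Heval1 //; apply: Gop.
- apply: A_ext (A_add (A_mul (A_const a) Ay) Az) => x Dx.
  by rewrite (Heval_linear (Gop x Dx)).
have Ag : A (fun x => coord (op x) g) by case: g => [w|w]; [apply: p1 | apply: p2].
apply: A_ext (A_mul Ag Ay) => x Dx.
by rewrite (HevalM (Gop x Dx)) Heval_gen //; apply: Gop.
Qed.

End PolynomialFunctions.

(** * Algebra morphisms dual to operations on G *)

Section Duality.
Variable R : realType.
Local Notation H := (Halg R).
Implicit Types (c d e : series2 R) (x y : H).

Definition rep1 (F : series2 R -> R) :=
  exists x, forall c, inG c -> Heval c x = F c.

Definition rep2 (F : series2 R * series2 R -> R) :=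
  exists t, forall c d, inG c -> inG d -> Heval2 c d t = F (c, d).

Lemma HevalA c a : inG c -> Heval c (a%:A) = a.
Proof.
move=> Gc; rewrite (linZ (Heval_linear Gc)) Heval1 //.
by rewrite -[LHS]/(a * 1) mulr1.
Qed.

Lemma rep1_ext F G : (forall c, inG c -> F c = G c) -> rep1 F -> rep1 G.
Proof. by move=> FG [x xF]; exists x => c Gc; rewrite xF // FG. Qed.

Lemma rep1_const a : rep1 (fun=> a).
Proof. by exists a%:A => c; apply: HevalA. Qed.

Lemma rep1_add F G : rep1 F -> rep1 G -> rep1 (fun c => F c + G c).
Proof.
move=> [x xF] [y yG]; exists (x + y) => c Gc.
by rewrite (linD (Heval_linear Gc)) xF // yG.
Qed.

Lemma rep1_mul F G : rep1 F -> rep1 G -> rep1 (fun c => F c * G c).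
Proof.
move=> [x xF] [y yG]; exists (x * y) => c Gc.
by rewrite (HevalM Gc) xF // yG.
Qed.

Lemma Heval2_linear c d : inG c -> inG d -> linear (Heval2 c d).
Proof. by move=> Gc Gd; apply: tens_ev_linear; apply: Heval_linear. Qed.

Lemma Heval2M c d s t : inG c -> inG d ->
  Heval2 c d (tens_mul s t) = Heval2 c d s * Heval2 c d t.
Proof.
move=> Gc Gd.
by apply: tens_ev_mul; try exact: Heval_linear; exact: HevalM.
Qed.

Let D2 (p : series2 R * series2 R) := inG p.1 /\ inG p.2.

Lemma rep2_ext F G : (forall p, D2 p -> F p = G p) -> rep2 F -> rep2 G.
Proof.
by move=> FG [x xF]; exists x => c d Gc Gd; rewrite xF // FG.
Qed.

Lemma rep2_tens F G : rep1 F -> rep1 G -> rep2 (fun p => F p.1 * G p.2).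
Proof.
move=> [x xF] [y yG]; exists (x ⊗ y) => c d Gc Gd.
by rewrite Heval2_tens // xF // yG.
Qed.

Lemma rep2_const a : rep2 (fun=> a).
Proof.
by apply: rep2_ext (rep2_tens (rep1_const a) (rep1_const 1)) => p _; rewrite mulr1.
Qed.

Lemma rep2_add F G : rep2 F -> rep2 G -> rep2 (fun p => F p + G p).
Proof.
move=> [x xF] [y yG]; exists (x + y) => c d Gc Gd.
by rewrite (linD (Heval2_linear Gc Gd)) xF // yG.
Qed.

Lemma rep2_mul F G : rep2 F -> rep2 G -> rep2 (fun p => F p * G p).
Proof.
move=> [x xF] [y yG]; exists (tens_mul x y) => c d Gc Gd.
by rewrite (Heval2M _ _ Gc Gd) xF // yG.
Qed.

Lemma rep1_coord g : rep1 (fun c => coord c g).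
Proof. by exists (gen R g) => c Gc; rewrite Heval_gen. Qed.

Lemma rep2_coordl g : rep2 (fun p => coord p.1 g).
Proof.
by apply: rep2_ext (rep2_tens (rep1_coord g) (rep1_const 1)) => p _; rewrite mulr1.
Qed.

Lemma rep2_coordr g : rep2 (fun p => coord p.2 g).
Proof.
by apply: rep2_ext (rep2_tens (rep1_const 1) (rep1_coord g)) => p _; rewrite mul1r.
Qed.

Lemma separating_Heval2 : separating (fun h : tensor H H -> R^o =>
  exists f g, [/\ exists2 c, inG c & f = Heval c, exists2 c, inG c & g = Heval c
    & h = tens_ev f g]).
Proof. exact: separating_tens (separating_Heval R) (separating_Heval R). Qed.

Lemma Heval_eq x y : (forall c, inG c -> Heval c x = Heval c y) -> x = y.
Proof.
move=> exy; apply: (separating_eq (separating_Heval R)) => _ [c Gc ->].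
exact: exy.
Qed.

Lemma Heval2_eq (s t : tensor H H) :
  (forall c d, inG c -> inG d -> Heval2 c d s = Heval2 c d t) -> s = t.
Proof.
move=> est; apply: (separating_eq separating_Heval2).
by move=> _ [_] [_] [[c Gc ->] [d Gd ->] ->]; apply: est.
Qed.

Definition preservesG (op : series2 R -> series2 R -> series2 R) :=
  forall c d, inG c -> inG d -> inG (op c d).

Lemma preservesG_tri : preservesG (@tri R).
Proof. by move=> c d Gc _; apply: inG_tri. Qed.

(** A representing tensor chosen for each x is unique by separation, which makes
    the choice linear and multiplicative. *)
Lemma dual_exists op : preservesG op ->
  polynomial rep2 (fun p => (op p.1 p.2).1) ->
  polynomial rep2 (fun p => (op p.1 p.2).2) ->
  exists f, is_dual_of op f.
Proof.
move=> Gop p1 p2.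
have ex := polynomial_Heval rep2_ext rep2_const rep2_add rep2_mul
  (fun p (Dp : D2 p) => Gop p.1 p.2 Dp.1 Dp.2) p1 p2.
have [f fE] := choice ex; exists f.
have {}fE c d x : inG c -> inG d -> Heval2 c d (f x) = Heval (op c d) x.
  by move=> *; rewrite fE.
split; last by move=> g c d Gc Gd; rewrite fE // Heval_gen //; apply: Gop.
split=> [a x y||x y]; apply: Heval2_eq => c d Gc Gd; have Gcd := Gop c d Gc Gd.
- by rewrite (Heval2_linear Gc Gd) !fE // (Heval_linear Gcd).
- by rewrite fE // Heval2_tens // !Heval1 // mulr1.
by rewrite Heval2M // !fE // HevalM.
Qed.

Lemma dual_eval op f c d x : preservesG op -> is_dual_of op f ->
  inG c -> inG d -> Heval2 c d (f x) = Heval (op c d) x.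
Proof.
move=> Gop [[fL f1 fM] fg] Gc Gd; have Gcd := Gop c d Gc Gd.
elim/Halg_ind: x => [|a x y IHx IHy|g x IHx].
- by rewrite f1 Heval2_tens // !Heval1 // mulr1.
- by rewrite fL (Heval2_linear Gc Gd) IHx IHy (Heval_linear Gcd).
by rewrite fM Heval2M // fg // IHx (HevalM Gcd) Heval_gen.
Qed.

Lemma coord_unit2 g : g != inl [::] -> coord (unit2 R) g = 0.
Proof. by case: g => [[|i w]|w]. Qed.

Lemma counit_eval eps x : is_counit eps -> eps x = Heval (unit2 R) x.
Proof.
have G1 := inG1 R.
move=> [[eL e1 eM] eg]; elim/Halg_ind: x => [|a x y IHx IHy|g x IHx].
- by rewrite e1 Heval1.
- by rewrite eL IHx IHy (Heval_linear G1).
rewrite eM (HevalM G1) IHx; congr (_ * _).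
have [->|g0] := eqVneq g (inl [::]); first by rewrite gen_unit e1 Heval1.
by rewrite eg // Heval_gen // coord_unit2.
Qed.

Lemma counit_exists : exists eps : H -> R^o, is_counit eps.
Proof.
have G1 := inG1 R.
exists (Heval (unit2 R)); split.
  by split; [apply: Heval_linear | rewrite Heval1 | apply: HevalM].
by move=> g g0; rewrite Heval_gen // coord_unit2.
Qed.

Lemma dot_poly (c d : series2 R * series2 R -> series2 R) :
  polynomial rep2 (fun p => (c p).1) -> polynomial rep2 (fun p => (c p).2) ->
  polynomial rep2 (fun p => (d p).1) -> polynomial rep2 (fun p => (d p).2) ->
  polynomial rep2 (fun p => (dot (c p) (d p)).1) /\
  polynomial rep2 (fun p => (dot (c p) (d p)).2).
Proof.
move=> pc1 pc2 pd1 pd2; have ps := polynomial_shuffle rep2_ext rep2_const rep2_add rep2_mul.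
split; first exact: ps.
by apply: (polynomial_add rep2_add) => //; apply: ps.
Qed.

Lemma tri_poly : polynomial rep2 (fun p => (tri p.1 p.2).1) /\
  polynomial rep2 (fun p => (tri p.1 p.2).2).
Proof.
have pc := polynomial_comp rep2_ext rep2_const rep2_add rep2_mul.
by split; apply: pc => w; first [exact: (rep2_coordl (inl w)) | exact: (rep2_coordl (inr w))
  | exact: (rep2_coordr (inl w)) | exact: (rep2_coordr (inr w))].
Qed.

(** The antipode is composition with the inverse of (G, dot). *)
Lemma antipode_exists : exists S : H -> H,
  linear S /\ forall x c, inG c -> Heval c (S x) = Heval (dot_inv c) x.
Proof.
have pinv : polynomial rep1 (fun c => shuffle_inv c.1).
  apply: (polynomial_inv rep1_ext rep1_const rep1_add rep1_mul) => w.
  exact: (rep1_coord (inl w)).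
have pinv2 : polynomial rep1 (fun c => (dot_inv c).2).
  apply: (polynomial_opp rep1_ext rep1_const rep1_mul).
  apply: (polynomial_shuffle rep1_ext rep1_const rep1_add rep1_mul) => // w.
  exact: (rep1_coord (inr w)).
have ex := polynomial_Heval rep1_ext rep1_const rep1_add rep1_mul
  (fun c => @inG_inv R c) pinv pinv2.
have [S SE] := choice ex; exists S; split=> // a x y; apply: Heval_eq => c Gc.
by rewrite (Heval_linear Gc) !SE // (Heval_linear (inG_inv Gc)).
Qed.

End Duality.

(** * Hopf algebra axioms from identities on G *)

Section DualMaps.
Variable R : realType.
Local Notation H := (Halg R).
Implicit Types (c d e : series2 R) (op : series2 R -> series2 R -> series2 R).
Implicit Types f g h k : H -> tensor H H.

Lemma dual_linear op f : is_dual_of op f -> linear f.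
Proof. by case=> -[]. Qed.

Lemma tens_ev_tmap_dual (V : lmodType R) (p : V -> R^o) op f c d
    (t : tensor H V) : preservesG op -> is_dual_of op f -> linear p ->
  inG c -> inG d ->
  tens_ev (Heval2 c d) p (tmap f id t) = tens_ev (Heval (op c d)) p t.
Proof.
move=> Gop fop pL Gc Gd; have fL := dual_linear fop.
rewrite tens_ev_tmap //; last exact: Heval2_linear.
by apply: eq_tens_ev => // x /=; apply: dual_eval.
Qed.

Lemma tens_ev_tmap_dualr (V : lmodType R) (p : V -> R^o) op f c d
    (t : tensor V H) : preservesG op -> is_dual_of op f -> linear p ->
  inG c -> inG d ->
  tens_ev p (Heval2 c d) (tmap id f t) = tens_ev p (Heval (op c d)) t.
Proof.
move=> Gop fop pL Gc Gd; have fL := dual_linear fop.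
rewrite tens_ev_tmap //; last exact: Heval2_linear.
by apply: eq_tens_ev => // x /=; apply: dual_eval.
Qed.

Lemma Heval3_eq (s t : tensor H (tensor H H)) :
  (forall c d e, inG c -> inG d -> inG e ->
    tens_ev (Heval c) (Heval2 d e) s = tens_ev (Heval c) (Heval2 d e) t) -> s = t.
Proof.
have sep := separating_tens (separating_Heval R) (separating_Heval2 R).
move=> est; apply: (separating_eq sep).
by move=> _ [_] [_] [[c Gc ->] [_ [_ [[d Gd ->] [e Ge ->] ->]]] ->]; apply: est.
Qed.

Lemma Heval3_eql (s t : tensor (tensor H H) H) :
  (forall c d e, inG c -> inG d -> inG e ->
    tens_ev (Heval2 c d) (Heval e) s = tens_ev (Heval2 c d) (Heval e) t) -> s = t.
Proof.
have sep := separating_tens (separating_Heval2 R) (separating_Heval R).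
move=> est; apply: (separating_eq sep).
by move=> _ [_] [_] [[_ [_ [[c Gc ->] [d Gd ->] ->]]] [e Ge ->] ->]; apply: est.
Qed.

(** Both the coassociativity of the coproducts, with a single operation, and the
    coaction law, with op1 = op2 = op4 = tri and op3 = star. *)
Lemma coassoc_dual op1 op2 op3 op4 f1 f2 f3 f4 x :
  preservesG op1 -> preservesG op2 -> preservesG op3 -> preservesG op4 ->
  is_dual_of op1 f1 -> is_dual_of op2 f2 -> is_dual_of op3 f3 -> is_dual_of op4 f4 ->
  (forall c d e, op2 (op1 c d) e = op4 c (op3 d e)) ->
  tassoc (tmap f1 id (f2 x)) = tmap id f3 (f4 x).
Proof.
move=> G1 G2 G3 G4 h1 h2 h3 h4 assoc; apply: Heval3_eq => c d e Gc Gd Ge.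
have [Lc Ld Le] := And3 (Heval_linear Gc) (Heval_linear Gd) (Heval_linear Ge).
rewrite tens_ev_tassoc // (tens_ev_tmap_dual _ G1 h1) // (tens_ev_tmap_dualr _ G3 h3) //.
rewrite [LHS](dual_eval _ G2 h2) //; last exact: G1.
by rewrite [RHS](dual_eval _ G4 h4) ?assoc //; apply: G3.
Qed.

Lemma counitl_dual op f eps x : preservesG op -> is_dual_of op f ->
  is_counit eps -> left_id (unit2 R) op -> tunitl (tmap eps id (f x)) = x.
Proof.
move=> Gop fop ep op1; apply: Heval_eq => c Gc.
have epL : linear eps by case: ep => -[].
rewrite ev_tunitl; last exact: Heval_linear.
rewrite tens_ev_tmap //; last exact: Heval_linear.
rewrite (eq_tens_ev (f' := Heval (unit2 R)) (g' := Heval c)) //.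
  by rewrite [LHS](dual_eval _ Gop fop) ?op1.
by move=> y /=; apply: counit_eval.
Qed.

Lemma counitr_dual op f eps x : preservesG op -> is_dual_of op f ->
  is_counit eps -> right_id (unit2 R) op -> tunitr (tmap id eps (f x)) = x.
Proof.
move=> Gop fop ep op1; apply: Heval_eq => c Gc.
have epL : linear eps by case: ep => -[].
rewrite ev_tunitr; last exact: Heval_linear.
rewrite tens_ev_tmap //; last exact: Heval_linear.
rewrite (eq_tens_ev (f' := Heval c) (g' := Heval (unit2 R))) //.
  by rewrite [LHS](dual_eval _ Gop fop) ?op1.
by move=> y /=; apply: counit_eval.
Qed.

Lemma bialgebra_dual op f eps : preservesG op -> is_dual_of op f ->
  is_counit eps -> associative op -> left_id (unit2 R) op ->
  right_id (unit2 R) op -> is_bialgebra f eps.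
Proof.
move=> Gop fop ep opA op1 opr1; split; [split| by case: fop | by case: ep].
- exact: dual_linear fop.
- by case: ep => -[].
- by move=> x; apply: (coassoc_dual x Gop Gop Gop Gop fop fop fop fop) => c d e; rewrite opA.
- by move=> x; apply: counitl_dual fop ep op1.
- by move=> x; apply: counitr_dual fop ep opr1.
Qed.

Lemma antipode_dual delta eps S : is_dual_of (@dot R) delta -> is_counit eps ->
  linear S -> (forall x c, inG c -> Heval c (S x) = Heval (dot_inv c) x) ->
  is_antipode delta eps S.
Proof.
move=> hd ep SL SE; have Gdot := @inG_dot R.
split=> // x; apply: Heval_eq => c Gc; have Gi := inG_inv Gc;
  rewrite HevalA // (counit_eval _ ep) ev_tmul ?tens_ev_tmap //;
  try exact: Heval_linear; try exact: HevalM.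
  rewrite (eq_tens_ev (f' := Heval (dot_inv c)) (g' := Heval c)) //.
    by rewrite [LHS](dual_eval _ Gdot hd) ?dot_invl.
  by move=> y; apply: SE.
rewrite (eq_tens_ev (f' := Heval c) (g' := Heval (dot_inv c))) //.
  by rewrite [LHS](dual_eval _ Gdot hd) ?dot_invr.
by move=> y; apply: SE.
Qed.

(** The coaction on the tensor square is dual to the diagonal action of G on
    G * G. *)
Lemma tens_ev_coaction_tri rho c d e t : is_dual_of (@tri R) rho ->
  inG c -> inG d -> inG e ->
  tens_ev (Heval2 c d) (Heval e) (tens_coaction rho rho t) =
  Heval2 (tri c e) (tri d e) t.
Proof.
move=> hr Gc Gd Ge; have rL := dual_linear hr.
have Gtri := @preservesG_tri R.
rewrite tens_ev_coaction //; try exact: Heval_linear; last exact: HevalM.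
by apply: eq_tens_ev => x /=; apply: (dual_eval _ Gtri hr).
Qed.

(** Evaluation at c ◁ d is multiplicative. *)
Lemma mul_comod rho : is_dual_of (@tri R) rho ->
  is_comod_morph (tens_coaction rho rho) rho (@tmul R H).
Proof.
move=> hr; have rL := dual_linear hr.
have Gtri := @preservesG_tri R.
split=> [|t]; first exact: tmul_linear.
apply: Heval2_eq => c d Gc Gd; have Gcd := Gtri c d Gc Gd.
have [Lc Ld] := conj (Heval_linear Gc) (Heval_linear Gd).
have mL := tmul_linear (A := H).
rewrite (dual_eval _ Gtri hr) // ev_tmul; [|exact: Heval_linear|exact: HevalM].
rewrite [RHS]tens_ev_tmap // (eq_tens_ev (f' := Heval2 c c) (g' := Heval d)) //.
  by rewrite tens_ev_coaction_tri.
by move=> x /=; apply: ev_tmul => //; apply: HevalM.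
Qed.

Lemma unit_comod rho : is_dual_of (@tri R) rho ->
  is_comod_morph (@triv_coaction R H) rho (fun r : R^o => r%:A).
Proof.
move=> hr; have rL := dual_linear hr.
have aL : linear (fun r : R^o => r%:A : H).
  by move=> a x y; rewrite scalerDl scalerA.
split=> // r; rewrite linZ // /triv_coaction tmapE //.
by case: hr => -[_ -> _] _; rewrite (linZ ((tens_bilinear H H).1 _)).
Qed.

(** Dual to (c · d) ◁ e = (c ◁ e) · (d ◁ e). *)
Lemma delta_comod rho delta : is_dual_of (@tri R) rho ->
  is_dual_of (@dot R) delta -> is_comod_morph rho (tens_coaction rho rho) delta.
Proof.
move=> hr hd; have rL := dual_linear hr; have dL := dual_linear hd.
have Gtri := @preservesG_tri R.
have Gdot := @inG_dot R.
split=> // x; apply: Heval3_eql => c d e Gc Gd Ge.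
have [Gce Gde] := conj (Gtri c e Gc Ge) (Gtri d e Gd Ge).
rewrite tens_ev_coaction_tri // (dual_eval _ Gdot hd) //.
rewrite (tens_ev_tmap_dual _ Gdot hd) //; last exact: Heval_linear.
by rewrite [RHS](dual_eval _ Gtri hr) ?tri_dot //; apply: Gdot.
Qed.

(** Dual to the invariance of the unit of G. *)
Lemma eps_comod rho eps : is_dual_of (@tri R) rho -> is_counit eps ->
  is_comod_morph rho (@triv_coaction R H) eps.
Proof.
move=> hr he; have rL := dual_linear hr; have eL : linear eps by case: he => -[].
have Gtri := @preservesG_tri R.
have G1 := inG1 R.
split=> // x.
apply: (separating_eq (separating_tens (separating_id R) (separating_Heval R))).
move=> _ [_] [_] [-> [c Gc ->] ->]; have Lc := Heval_linear Gc.
rewrite tens_evE // Heval1 // mulr1 tens_ev_tmap //.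
rewrite (eq_tens_ev (f' := Heval (unit2 R)) (g' := Heval c)) //.
  by rewrite [RHS](dual_eval _ Gtri hr) // tri1; apply: counit_eval.
by move=> y; apply: counit_eval.
Qed.

(** Dual to (c ◁ d)^-1 = c^-1 ◁ d. *)
Lemma antipode_comod rho S : is_dual_of (@tri R) rho -> linear S ->
  (forall x c, inG c -> Heval c (S x) = Heval (dot_inv c) x) ->
  is_comod_morph rho rho S.
Proof.
move=> hr SL SE; have rL := dual_linear hr.
have Gtri := @preservesG_tri R.
split=> // x; apply: Heval2_eq => c d Gc Gd; have Gi := inG_inv Gc.
have [Lc Ld] := conj (Heval_linear Gc) (Heval_linear Gd).
have Gcd := Gtri c d Gc Gd.
rewrite (dual_eval _ Gtri hr) // SE // -tri_inv //.
rewrite [RHS]tens_ev_tmap // (eq_tens_ev (f' := Heval (dot_inv c)) (g' := Heval d)) //.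
  by rewrite [RHS](dual_eval _ Gtri hr).
by move=> y; apply: SE.
Qed.

End DualMaps.

Theorem mainTheorem2 (R : realType) :
  (exists (delta Delta rho : Halg R -> tensor (Halg R) (Halg R))
          (eps : Halg R -> (R^o)%type),
     [/\ is_dual_of (@dot R) delta, is_dual_of (@star R) Delta,
         is_dual_of (@tri R) rho & is_counit eps]) /\
  (forall (delta Delta rho : Halg R -> tensor (Halg R) (Halg R))
          (eps : Halg R -> (R^o)%type),
     is_dual_of (@dot R) delta -> is_dual_of (@star R) Delta ->
     is_dual_of (@tri R) rho -> is_counit eps ->
     is_Hopf_in_comod Delta eps delta eps rho).
Proof.
have Gtri := @preservesG_tri R.
have Gdot := @inG_dot R; have Gstar := @inG_star R.
split.
  have pl1 : polynomial (@rep2 R) (fun p => p.1.1) := fun w => rep2_coordl R (inl w).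
  have pl2 : polynomial (@rep2 R) (fun p => p.1.2) := fun w => rep2_coordl R (inr w).
  have pr1 : polynomial (@rep2 R) (fun p => p.2.1) := fun w => rep2_coordr R (inl w).
  have pr2 : polynomial (@rep2 R) (fun p => p.2.2) := fun w => rep2_coordr R (inr w).
  have [pd1 pd2] := dot_poly pl1 pl2 pr1 pr2.
  have [pt1 pt2] := tri_poly R.
  have [ps1 ps2] := dot_poly pt1 pt2 pr1 pr2.
  have [delta hd] := dual_exists Gdot pd1 pd2.
  have [Delta hD] := dual_exists Gstar ps1 ps2.
  have [rho hr] := dual_exists Gtri pt1 pt2.
  have [eps he] := counit_exists R.
  by exists delta, Delta, rho, eps.
move=> delta Delta rho eps hd hD hr he.
have [S [SL SE]] := antipode_exists R.
split.
- exact: (bialgebra_dual Gstar hD he (@starA R) (@star1 R) (@starr1 R)).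
- split=> [|x|x]; first exact: dual_linear hr.
    by apply: (coassoc_dual x Gtri Gtri Gstar Gtri hr hr hD hr) => c d e; rewrite tri_tri.
  exact: (counitr_dual x Gtri hr he (@trir1 R)).
- exact: (bialgebra_dual Gdot hd he (@dotA R) (@dot1 R) (@dotr1 R)).
- exact: mul_comod.
- exact: unit_comod.
- exact: delta_comod.
- exact: eps_comod.
exists S; first exact: antipode_dual.
exact: antipode_comod.
Qed.
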